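(* The multiplication in the algebra $\mathcal H_{q,a}=e\mathbb C Ge$, with basis $\{T_x\mid x\in WH_b\}$, is determined by the following relations (all of which hold in $\mathcal H_{q,a}$). (1) If $d,d'\in H_b$, then $T_{d'}T_d=T_{d'd}$. Thus the rule $d\mapsto T_d$ extends linearly to an algebra isomorphism between the group algebra $\mathbb C H_b$ and the subset of $\mathcal H_{q,a}$ spanned by $\{T_d\mid d\in H_b\}$. (2) If $d\in H_b$ and $w\in W$, then $T_wT_d=T_{wd}$ and $T_dT_w=T_{dw}$. (3) If $w\in W$ and $s\in\mathcal S$, then \[ T_wT_s=\begin{cases}T_{ws}&\text{if }\ell(ws)>\ell(w),\\ qT_{ws}+a\sum_{d\in X_s}T_{wd}&\text{if }\ell(ws)<\ell(w).\end{cases} \]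
   Context: Let $q$ be a prime power, $n\ge 1$, $G=\mathrm{GL}_n(\mathbb F_q)$, and let $a,b$ be relatively prime positive integers with $ab=q-1$. The cyclic group $\mathbb F_q^\times$ is the direct product of its subgroup $F_a$ of order $a$ and its subgroup $F_b$ of order $b$. Let $H_a$, $H_b$ be the groups of diagonal matrices in $G$ with entries in $F_a$, $F_b$ respectively, $U$ the group of upper triangular unipotent matrices in $G$, and $B_a=H_aU$. Let $W\subset G$ be the group of permutation matrices; $WH_b$ is a subgroup of $G$, and it is a complete set of $(B_a,B_a)$-double coset representatives in $G$. Let $e=|B_a|^{-1}\sum_{g\in B_a}g\in\mathbb C B_a$ and $\mathcal H_{q,a}=e\,\mathbb C G\,e$. For $x\in WH_b$ let $T_x=|B_a|^{-1}\sum_{g\in B_axB_a}g\in\mathbb C G$. The elements $T_x$, $x\in WH_b$, form a $\mathbb C$-basis of $\mathcal H_{q,a}$. $\mathcal S=\{s_1,\dots,s_{n-1}\}$, where $s_i$ is the permutation matrix of the transposition $(i,i+1)$, and $\ell$ is the length function of the Coxeter group $(W,\mathcal S)$. For $\alpha\in F_b$, $h_i(\alpha)$ is the diagonal matrix with $i$-th diagonal entry $\alpha$ and other diagonal entries $1$, and for $i\neq j$, $h_{i,j}(\alpha)=h_i(\alpha)h_j((-1)^{b-1}\alpha^{-1})$. For $s=s_i$, $X_{s}=\{h_{i,i+1}(\alpha)\mid\alpha\in F_b\}\subseteq H_b$. *)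

(* Defs.v *)
From HB Require Import structures.
From mathcomp Require Import all_boot all_order all_fingroup all_algebra.
From mathcomp Require Import mxrepresentation complex reals.

Set Implicit Arguments.
Unset Strict Implicit.
Unset Printing Implicit Defensive.

Import GRing.Theory.
Local Open Scope ring_scope.

Section WordLength.
Variables (gT : finGroupType) (S : {set gT}).

Lemma gen_word w : w \in <<S>>%g -> exists k, w \in (S ^+ k)%g.
Proof.
case/gen_prodgP=> k [c Sc ->]; exists k.
elim: k c Sc => [|k IHk] c Sc; first by rewrite big_ord0 expg0 set11.
by rewrite big_ord_recl expgS mem_mulg ?IHk.
Qed.

(* [S ^+ k] is the set of products of k elements of S.  The value 0 outside   *)
(* of the group generated by S is a dummy.                                    *)
Definition word_length (w : gT) : nat :=
  if @idP (w \in <<S>>%g) is ReflectT genw then ex_minn (gen_word genw) else 0%N.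

End WordLength.

Section GroupAlgebra.
Variables (K : fieldType) (gT : finGroupType).

(* The group algebra of gT is realised inside the regular representation, as  *)
(* in [group_ring]; the matrix product is the product of the group algebra.   *)
Notation gmat := 'M[K]_#|[set: gT]|.

Definition gelt (g : gT) : gmat := regular_repr K [set: gT] g.

Definition gsum (A : {set gT}) : gmat := gset_mx K [set: gT] A.

(* Linear span of A in the group algebra of gT; when A is a subgroup, this is *)
(* the group algebra of A.                                                    *)
Definition galg (A : {set gT}) : {vspace gmat} := <<[seq gelt g | g in A]>>%VS.

Lemma galgT (X : gmat) :
  (X \in galg [set: gT]) = (X \in group_ring K [set: gT])%MS.
Proof.
apply/idP/idP=> [/coord_span-> | /envelop_mxP[c ->]].
  rewrite linear_sum summx_sub // => i _; rewrite linearZ scalemx_sub //.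
  have /imageP[g Gg ->] : [seq gelt g | g in [set: gT]]`_i
      \in [seq gelt g | g in [set: gT]] by rewrite mem_nth // size_image.
  exact: envelop_mx_id.
apply: memv_suml => g Gg; apply/memvZ/memv_span/imageP.
by exists g.
Qed.

End GroupAlgebra.

Section Subgroups.
Variables (F : finFieldType) (n : nat).
Notation gT := {'GL_n[F]}.
Notation "''J'" := 'I_n.-1.+1.

Fact diag_GL_subproof (u : {ffun 'J -> {unit F}}) :
  diag_mx (\row_j val (u j)) \is a @GRing.unit 'M[F]_n.-1.+1.
Proof.
rewrite -[_ \is a _]/(_ \in unitmx) unitmxE det_diag rpred_prod // => j _.
by rewrite mxE (valP (u j)).
Qed.

Definition diag_GL (u : {ffun 'J -> {unit F}}) : gT :=
  FinRing.unit 'M[F]_n.-1.+1 (diag_GL_subproof u).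

Definition perm_GL (s : {perm 'J}) : gT :=
  FinRing.unit 'M[F]_n.-1.+1 (unitmx_perm F s).

Definition diagonals (A : {set {unit F}}) : {set gT} :=
  [set diag_GL u | u in ffun_on A].

Definition unitriangular : {set gT} :=
  [set g | is_trig_mx (GLval g)^T && [forall i, GLval g i i == 1]].

Definition borel (A : {set {unit F}}) : {set gT} :=
  (diagonals A * unitriangular)%g.

Definition weyl : {set gT} := [set perm_GL s | s : {perm 'J}].

(* Indices start from 0: [simple_refl i] exchanges i and i.+1.                *)
Definition simple_refl (i : 'I_n.-1) : gT :=
  perm_GL (tperm (widen_ord (leqnSn _) i) (lift ord0 i)).

Definition weyl_length (w : gT) : nat :=
  word_length [set simple_refl i | i : 'I_n.-1] w.

Definition h1 (i : 'J) (x : {unit F}) : gT :=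
  diag_GL [ffun j => if j == i then x else 1%g].

Definition unitN1 : {unit F} := FinRing.unit F (unitrN1 F).

Definition h2 (b : nat) (i j : 'J) (x : {unit F}) : gT :=
  (h1 i x * h1 j (unitN1 ^+ (b - 1) * x^-1))%g.

Definition Xset (Fb : {set {unit F}}) (i : 'I_n.-1) : {set gT} :=
  [set h2 #|Fb| (widen_ord (leqnSn _) i) (lift ord0 i) x | x in Fb].

End Subgroups.

Section Hecke.
Variables (K : fieldType) (F : finFieldType) (n : nat).
Variables (Fa Fb : {set {unit F}}).
Notation gT := {'GL_n[F]}.
Notation gmat := 'M[K]_#|[set: gT]|.
Notation Ba := (borel n Fa).
Notation Hb := (diagonals n Fb).
Notation W := (weyl F n).

Definition hecke_idem : gmat := #|Ba|%:R^-1 *: gsum K Ba.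

Definition hecke : {vspace gmat} :=
  (linfun (fun X : gmat => hecke_idem *m X *m hecke_idem)
     @: galg K [set: gT])%VS.

Definition hecke_T (x : gT) : gmat := #|Ba|%:R^-1 *: gsum K (Ba :* x * Ba)%g.

Notation T := hecke_T.

Definition hecke_relations (mul : gmat -> gmat -> gmat) : Prop :=
  [/\ {in Hb &, forall d' d, mul (T d') (T d) = T (d' * d)%g},
      {in W & Hb, forall w d,
         mul (T w) (T d) = T (w * d)%g /\ mul (T d) (T w) = T (d * w)%g}
    & {in W, forall w (i : 'I_n.-1), let s := simple_refl F i in
         ((weyl_length w < weyl_length (w * s)%g)%N ->
            mul (T w) (T s) = T (w * s)%g)
      /\ ((weyl_length (w * s)%g < weyl_length w)%N ->
            mul (T w) (T s) = #|F|%:R *: T (w * s)%g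
                      + #|Fa|%:R *: \sum_(d in Xset Fb i) T (w * d)%g)}].

End Hecke.

Arguments hecke_T K {F n} Fa x.
Arguments hecke_relations K {F} n Fa Fb mul.

(* mul restricts to an associative bilinear multiplication on U.             *)
Definition algebra_law (K : fieldType) (V : vectType K) (U : {vspace V})
    (mul : V -> V -> V) : Prop :=
  [/\ {in U &, forall x y, mul x y \in U},
      forall c, {in U & &, forall x y z,
        mul (c *: x + y) z = c *: mul x z + mul y z},
      forall c, {in U & &, forall x y z,
        mul x (c *: y + z) = c *: mul x y + mul x z}
    & {in U & &, associative mul}].

(* Main.v *)
Require Import Defs.
From mathcomp Require Import all_boot all_order all_fingroup all_algebra.
From mathcomp Require Import mxrepresentation complex reals.
From mathcomp Require Import cyclic classfun.

(** With [e] the idempotent of [B_a], each [T_x] is the multiple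
    [|B_a x B_a| / |B_a|] of [e x e], so products reduce to expanding the middle
    idempotent of [e x e y e] over [B_a].  An element [b] of [B_a] factors as a
    root element [u] for [s] times an element that [s] conjugates into [B_a];
    if [l(ws) > l(w)], then [w] conjugates [u] into [U], every term of
    [e w e s e] is [e ws e], and [|B_a ws B_a| = q |B_a w B_a|].  For [w = s], the
    rank one identity writes [s u s], for [u] with parameter [x <> 0], as an
    element of [B_a s diag(x, -1/x) B_a]; grouping the [x] by their component in
    [F_b] gives the quadratic relation.  The length is the number of inversions.
    A multiplication satisfying the relations agrees with the matrix product when
    the right factor is some [T_d] or [T_s], and these generate the algebra. *)

Set Implicit Arguments.
Unset Strict Implicit.
Unset Printing Implicit Defensive.

Import GRing.Theory.
Local Open Scope ring_scope.

(** * Sums over subsets in the group algebra *)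

Section GroupAlgebraSums.
Variables (K : fieldType) (gT : finGroupType).
Notation gelt := (@gelt K gT).
Notation gsum := (@gsum K gT).

Lemma geltM x y : gelt (x * y)%g = gelt x *m gelt y.
Proof. by rewrite /Defs.gelt repr_mxM ?inE. Qed.

Lemma gsumE A : gsum A = \sum_(g in A) gelt g.
Proof. by []. Qed.

Lemma mul_gelt_gsum x A : gelt x *m gsum A = gsum (x *: A)%g.
Proof.
rewrite !gsumE mulmx_sumr -lcosetE big_imset /=; last by move=> y z _ _ /mulgI.
by apply: eq_bigr => y _; rewrite geltM.
Qed.

Lemma mul_gsum_gelt x A : gsum A *m gelt x = gsum (A :* x)%g.
Proof.
rewrite !gsumE mulmx_suml -rcosetE big_imset /=; last by move=> y z _ _ /mulIg.
by apply: eq_bigr => y _; rewrite geltM.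
Qed.

(** Among the sets [A_ y] with [y] in [D], only [A_ x] contains [x], so reading off the coefficient
    of [x] in a vanishing combination isolates a single scalar. *)
Lemma free_gsum (c : K) (D : {set gT}) (A_ : gT -> {set gT}) :
    c != 0 -> {in D, forall x, x \in A_ x} ->
    {in D &, forall x y, x \in A_ y -> x = y} ->
  free [seq c *: gsum (A_ x) | x in D].
Proof.
move=> nz_c DA injA; pose m := size [seq c *: gsum (A_ x) | x in D].
have def_m : m = size (enum D) by rewrite /m size_image cardE.
rewrite -[image _ _]in_tupleE; apply/freeP=> k /= k0 j; rewrite -/m in k k0 j *.
pose x (i : 'I_m) := nth 1%g (enum D) i.
have Dx i : x i \in D by rewrite -mem_enum mem_nth // -def_m.
have xE (i : 'I_m) : [seq c *: gsum (A_ x) | x in D]`_i = c *: gsum (A_ (x i)).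
  by rewrite (nth_map 1%g) // -def_m.
have coefA y A : @gring_proj _ _ [set: gT]%G y (gsum A) = (y \in A)%:R :> 'M[K]_1.
  rewrite gsumE linear_sum /=.
  rewrite (eq_bigr (fun z => (y == z)%:R)); last first.
    by move=> z _; rewrite gring_projE ?inE.
  have [Ay|/negP A'y] := boolP (y \in A).
    rewrite (bigD1 y) //= eqxx big1 ?addr0 // => z /andP[_ /negPf].
    by rewrite eq_sym => ->.
  by apply: big1 => z Az; case: eqP => // zy; case: A'y; rewrite zy.
have := congr1 (@gring_proj _ _ [set: gT]%G (x j)) k0; rewrite linear0 linear_sum /=.
rewrite (bigD1 j) //= xE !linearZ /= coefA DA // big1 => [|i ne_ij].
  rewrite addr0 scalerA => /matrixP/(_ 0 0); rewrite !mxE eqxx mulr1.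
  by move/eqP; rewrite mulf_eq0 (negPf nz_c) orbF => /eqP.
rewrite xE !linearZ /= coefA; case: (boolP (_ \in _)) => [Aij|]; last first.
  by rewrite !scaler0.
case/eqP: ne_ij; apply/val_inj/eqP; have := injA _ _ (Dx j) (Dx i) Aij.
by move/eqP; rewrite nth_uniq ?enum_uniq -?def_m // eq_sym.
Qed.

End GroupAlgebraSums.

Lemma natr_card_neq0 (K : fieldType) (T : finType) (A : {pred T}) x :
  [pchar K] =i pred0 -> x \in A -> #|A|%:R != 0 :> K.
Proof.
by move=> charK Ax; rewrite (pcharf0P K).1 // -lt0n; apply/card_gt0P; exists x.
Qed.

(** * The averaging idempotent of a subgroup and its double coset sums *)

Section DoubleCosets.
Variables (K : fieldType) (gT : finGroupType) (B : {group gT}).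
Hypothesis charK : [pchar K] =i pred0.
Notation gelt := (@gelt K gT).
Notation gsum := (@gsum K gT).
Let e := #|B|%:R^-1 *: gsum B.
Let T x := #|B|%:R^-1 *: gsum (B :* x * B)%g.

Let B_neq0 : #|B|%:R != 0 :> K := natr_card_neq0 charK (group1 B).

Lemma mul_gelt_idem b : b \in B -> gelt b *m e = e.
Proof. by move=> Bb; rewrite -scalemxAr mul_gelt_gsum lcoset_id. Qed.

Lemma mul_idem_gelt b : b \in B -> e *m gelt b = e.
Proof. by move=> Bb; rewrite -scalemxAl mul_gsum_gelt rcoset_id. Qed.

(** Translation by each [b] in [B] maps [A] onto itself, so the product is an average of equal
    terms. *)
Lemma idem_gsumL A : (B * A)%g = A -> e *m gsum A = gsum A.
Proof.
move=> BA; rewrite -scalemxAl gsumE mulmx_suml.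
rewrite (eq_bigr (fun=> gsum A)); last first.
  move=> b Bb; rewrite mul_gelt_gsum; congr (gsum _).
  apply/eqP; rewrite eqEcard card_lcoset leqnn andbT -{2}BA.
  by rewrite mulSg ?sub1set.
by rewrite sumr_const -scaler_nat scalerA mulVf ?scale1r.
Qed.

Lemma idem_gsumR A : (A * B)%g = A -> gsum A *m e = gsum A.
Proof.
move=> AB; rewrite -scalemxAr gsumE mulmx_sumr.
rewrite (eq_bigr (fun=> gsum A)); last first.
  move=> b Bb; rewrite mul_gsum_gelt; congr (gsum _).
  apply/eqP; rewrite eqEcard card_rcoset leqnn andbT -{2}AB.
  by rewrite mulgS ?sub1set.
by rewrite sumr_const -scaler_nat scalerA mulVf ?scale1r.
Qed.

Lemma idem_idem : e *m e = e.
Proof. by rewrite {2 3}/e -scalemxAr idem_gsumL ?mulGid. Qed.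

Lemma idem_dcoset_sum x : e *m T x = T x.
Proof. by rewrite -scalemxAr idem_gsumL // !mulgA mulGid. Qed.

Lemma dcoset_sum_idem x : T x *m e = T x.
Proof. by rewrite -scalemxAl idem_gsumR // -!mulgA mulGid. Qed.

Lemma idem_mul_dcoset b x c : b \in B -> c \in B ->
  e *m gelt (b * x * c)%g *m e = e *m gelt x *m e.
Proof.
by move=> Bb Bc; rewrite !geltM !mulmxA mul_idem_gelt // -!mulmxA mul_gelt_idem.
Qed.

(* Summing [e g e] over the double coset counts [e x e] once per element, while
   [e] fixes the sum of the double coset on both sides. *)
Lemma dcoset_sumE x : T x = (#|(B :* x * B)%g|%:R / #|B|%:R) *: (e *m gelt x *m e).
Proof.
rewrite mulrC -scalerA; congr (_ *: _).
have <- : e *m gsum (B :* x * B)%g *m e = gsum (B :* x * B)%g.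
  by rewrite idem_gsumL ?idem_gsumR // ?mulgA ?mulGid // -!mulgA mulGid.
rewrite gsumE mulmx_sumr mulmx_suml (eq_bigr (fun=> e *m gelt x *m e)).
  by rewrite sumr_const scaler_nat.
move=> _ /mulsgP[_ c /rcosetP[b Bb ->] Bc ->]; exact: idem_mul_dcoset.
Qed.

Lemma dcoset_sum_dcoset b x c : b \in B -> c \in B -> T (b * x * c)%g = T x.
Proof.
move=> Bb Bc; congr (_ *: gsum _).
by rewrite !rcosetM rcoset_id // -mulgA lcoset_id.
Qed.

Lemma dcoset_sum1 : T 1%g = e.
Proof. by rewrite /T rcoset1 mulGid. Qed.

(** The double coset of a normalising element is a single coset, so no scalar appears. *)
Lemma dcoset_sum_norm d : d \in 'N(B)%g -> T d = gelt d *m e.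
Proof.
move=> nBd; rewrite /T norm_rlcoset // -mulgA mulGid.
by rewrite -scalemxAr mul_gelt_gsum.
Qed.

Lemma norm_idem d : d \in 'N(B)%g -> gelt d *m e = e *m gelt d.
Proof.
by move=> nBd; rewrite -scalemxAr -scalemxAl mul_gelt_gsum mul_gsum_gelt norm_rlcoset.
Qed.

(** Translation by [d] sends double cosets to double cosets. The relations involving some [T d] with
    [d] diagonal are instances, since diagonal matrices normalise the Borel group. *)
Lemma mul_norm_dcoset_sum d x : d \in 'N(B)%g -> T d *m T x = T (d * x)%g.
Proof.
move=> nBd; rewrite (dcoset_sum_norm nBd) -mulmxA idem_dcoset_sum.
rewrite -scalemxAr mul_gelt_gsum.
by rewrite /T rcosetM (norm_rlcoset nBd) !mulgA.
Qed.

Lemma mul_dcoset_sum_norm d x : d \in 'N(B)%g -> T x *m T d = T (x * d)%g.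
Proof.
move=> nBd; rewrite (dcoset_sum_norm nBd) norm_idem // mulmxA dcoset_sum_idem -scalemxAl.
by rewrite mul_gsum_gelt /T -mulgA (norm_rlcoset nBd) !mulgA rcosetM.
Qed.

End DoubleCosets.

(** * Adjacent transpositions and inversions of permutations *)

Section Inversions.
Variable m : nat.
Notation "''J'" := 'I_m.+1.
Implicit Types (r s : {perm 'J}) (i : 'I_m) (j k : 'J).
Notation lo i := (widen_ord (leqnSn _) i).
Notation hi i := (lift ord0 i).
Notation tau i := (tperm (lo i) (hi i)).

(** The two sides have the same sum over [j], because [s] permutes the indices; hence every
    inequality is an equality. *)
Lemma perm_le_eq1 s : (forall j, j <= s j)%N -> s = 1%g.
Proof.
move=> le_s; have [_ /esym] : (\sum_(j : 'J) j <= \sum_(j : 'J) s j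
    ?= iff [forall j : 'J, j == s j :> nat])%N.
  by apply: leqif_sum => j _; split; rewrite ?le_s.
rewrite [X in _ == X](_ : _ = \sum_(j : 'J) j)%N; last first.
  by rewrite [RHS](reindex_inj (@perm_inj _ s)).
rewrite eqxx => /forallP eq_s; apply/permP=> j; rewrite perm1; apply/val_inj/eqP.
by rewrite eq_sym eq_s.
Qed.

Lemma lo_lt_hi i : (lo i < hi i)%N.
Proof. by rewrite /= /bump add1n. Qed.

Lemma perm_lo_hi_neq r i : (r (lo i) == r (hi i) :> nat) = false.
Proof. by rewrite (inj_eq val_inj) (inj_eq perm_inj) -val_eqE ltn_eqF ?lo_lt_hi. Qed.

(** An increasing [r] satisfies [j <= r j], by induction on [j]. *)
Lemma perm_ascents_eq1 r : (forall i, r (lo i) < r (hi i))%N -> r = 1%g.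
Proof.
move=> asc_r; apply: perm_le_eq1 => -[j]; elim: j => //= j IHj lt_j.
have := asc_r (Ordinal (ltnSE lt_j : j < m)%N).
have -> : lo (Ordinal (ltnSE lt_j)) = Ordinal (ltnW lt_j) by apply: val_inj.
have -> : hi (Ordinal (ltnSE lt_j)) = Ordinal lt_j.
  by apply: val_inj; rewrite /= /bump add1n.
exact: leq_ltn_trans.
Qed.

(** This serves twice: in counting inversions, and in showing that conjugation by a simple
    reflection moves only one entry of an upper triangular matrix below the diagonal. *)
Lemma tau_lt i j k :
  (j < k)%N -> (tau i j < tau i k)%N \/ j = lo i /\ k = hi i.
Proof.
move=> lt_jk; have := lt_jk.
case: (tpermP (lo i) (hi i) j) => [def_j|def_j|/eqP ne_j0 /eqP ne_j1];
  case: (tpermP (lo i) (hi i) k) => [def_k|def_k|/eqP ne_k0 /eqP ne_k1].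
- by rewrite def_j def_k ltnn.
- by right.
- rewrite def_j /= /bump add1n => lt_ik; left; rewrite ltn_neqAle lt_ik andbT.
  by move: ne_k1; rewrite -val_eqE /= /bump add1n eq_sym.
- by rewrite def_j def_k ltnNge ltnW ?lo_lt_hi.
- by rewrite def_j def_k ltnn.
- by rewrite def_j => /(ltn_trans (lo_lt_hi i)); left.
- by rewrite def_k => /ltn_trans/(_ (lo_lt_hi i)); left.
- rewrite def_k /= /bump add1n ltnS => le_ji; left; rewrite ltn_neqAle le_ji andbT.
  by move: ne_j0; rewrite -val_eqE.
- by left.
Qed.

Definition inversions r : {set 'J * 'J} :=
  [set p : 'J * 'J | (p.1 < p.2)%N && (r p.2 < r p.1)%N].

(** Applying [tau i] to both coordinates maps the inversions of [r] injectively to those of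
    [tau i * r]; the only one missed is the new pair [(lo i, hi i)]. *)
Lemma card_inversions_tau r i : (r (lo i) < r (hi i))%N ->
  #|inversions (tau i * r)%g| = #|inversions r|.+1.
Proof.
move=> asc_r; pose f (p : 'J * 'J) := (tau i p.1, tau i p.2).
have fK : involutive f by case=> j k; rewrite /f /= !tpermK.
have f_inj := can_inj fK.
suffices -> : inversions (tau i * r)%g = (lo i, hi i) |: f @: inversions r.
  rewrite cardsU1 card_imset //; case: imsetP => // -[[j k]].
  rewrite inE /= => /andP[lt_jk _] [/(canLR (tpermK _ _)) def_j].
  move/(canLR (tpermK _ _)) => def_k; move: lt_jk.
  by rewrite -def_j -def_k tpermL tpermR ltnNge ltnW ?lo_lt_hi.
apply/setP=> -[j k]; rewrite !inE /= !permM xpair_eqE.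
apply/andP/orP=> [[lt_jk lt_r]|[/andP[/eqP-> /eqP->]|]].
- have [lt_t|[-> ->]] := tau_lt i lt_jk; last by left; rewrite !eqxx.
  by right; apply/imsetP; exists (f (j, k)); rewrite ?fK // inE /= lt_t.
- by rewrite lo_lt_hi tpermL tpermR.
case/imsetP=> -[j' k']; rewrite inE /= => /andP[lt_jk lt_r] [-> ->].
rewrite !tpermK; split=> //; have [//|[def_j def_k]] := tau_lt i lt_jk.
by move: lt_r; rewrite def_j def_k ltnNge ltnW.
Qed.

Lemma inversions1 : inversions 1%g = set0.
Proof.
apply/setP=> -[j k]; rewrite !inE /= !perm1.
by apply/negP=> /andP[/ltn_trans lt_jk /lt_jk]; rewrite ltnn.
Qed.

End Inversions.

(** * Diagonal, permutation and upper triangular matrices *)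

Section MatrixGroups.
Variables (F : finFieldType) (n : nat).
Notation gT := {'GL_n[F]}.
Notation "''J'" := 'I_n.-1.+1.
Implicit Types (g h : gT) (s t : {perm 'J}) (u v : {ffun 'J -> {unit F}}).
Implicit Types (A : {group {unit F}}) (i : 'I_n.-1) (j k l : 'J).

Lemma eq_GLP g h : (forall j k, g j k = h j k) -> g = h.
Proof. by move=> eq_gh; apply/val_inj/matrixP. Qed.

Lemma mul_GLE g h j k : GLval (g * h)%g j k = \sum_l g j l * h l k.
Proof. by rewrite GL_MxE mxE. Qed.

Lemma one_GLE j k : GLval (1%g : gT) j k = (j == k)%:R.
Proof. by rewrite GL_1E mxE. Qed.

Lemma diag_GLE u j k : diag_GL u j k = val (u j) *+ (j == k).
Proof. by rewrite !mxE. Qed.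

Lemma perm_GLE s j k : perm_GL F s j k = (s j == k)%:R.
Proof. by rewrite !mxE. Qed.

Lemma mul_diag_GL u g j k : GLval (diag_GL u * g)%g j k = val (u j) * g j k.
Proof.
rewrite mul_GLE (bigD1 j) //= diag_GLE eqxx big1 ?addr0 // => l.
by rewrite diag_GLE eq_sym => /negPf->; rewrite mul0r.
Qed.

Lemma mul_GL_diag u g j k : GLval (g * diag_GL u)%g j k = g j k * val (u k).
Proof.
rewrite mul_GLE (bigD1 k) //= diag_GLE eqxx big1 ?addr0 // => l.
by rewrite diag_GLE => /negPf->; rewrite mulr0.
Qed.

Lemma mul_perm_GL s g j k : GLval (perm_GL F s * g)%g j k = g (s j) k.
Proof.
rewrite mul_GLE (bigD1 (s j)) //= perm_GLE eqxx mul1r big1 ?addr0 // => l.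
by rewrite perm_GLE eq_sym => /negPf->; rewrite mul0r.
Qed.

Lemma mul_GL_perm s g j k : GLval (g * perm_GL F s)%g j k = g j (s^-1 k)%g.
Proof.
rewrite mul_GLE (bigD1 (s^-1 k)%g) //= perm_GLE permKV eqxx mulr1 big1 ?addr0 //.
move=> l; rewrite perm_GLE => ne_l; case: eqP => [def_k|]; last by rewrite mulr0.
by rewrite -def_k permK eqxx in ne_l.
Qed.

Lemma diag_GLM u v : diag_GL [ffun j => u j * v j]%g = (diag_GL u * diag_GL v)%g.
Proof.
by apply: eq_GLP => j k; rewrite mul_diag_GL !diag_GLE ffunE -mulrnAr.
Qed.

Lemma diag_GL1 : diag_GL [ffun=> 1%g] = 1%g :> gT.
Proof. by apply: eq_GLP => j k; rewrite diag_GLE ffunE one_GLE. Qed.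

Lemma diag_GLV u : diag_GL [ffun j => (u j)^-1]%g = (diag_GL u)^-1%g.
Proof.
apply: (mulIg (diag_GL u)); rewrite mulVg -diag_GLM -diag_GL1.
by congr (diag_GL _); apply/ffunP=> j; rewrite !ffunE mulVg.
Qed.

Lemma perm_GLM s t : perm_GL F (s * t)%g = (perm_GL F s * perm_GL F t)%g.
Proof. by apply: eq_GLP => j k; rewrite mul_perm_GL !perm_GLE permM. Qed.

Lemma perm_GL1 : perm_GL F 1%g = 1%g :> gT.
Proof. by apply: eq_GLP => j k; rewrite perm_GLE one_GLE perm1. Qed.

Lemma perm_GLV s : perm_GL F s^-1%g = (perm_GL F s)^-1%g.
Proof.
by apply: (mulIg (perm_GL F s)); rewrite mulVg -perm_GLM mulVg perm_GL1.
Qed.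

Lemma perm_GL_inj : injective (@perm_GL F n).
Proof.
move=> s t eq_st; apply/permP=> j; apply/eqP.
have := congr1 (fun g : gT => g j (t j)) eq_st; rewrite !perm_GLE eqxx.
by case: eqP => // _ /eqP; rewrite eq_sym oner_eq0.
Qed.

Lemma perm_diag_GL s u :
  (perm_GL F s * diag_GL u = diag_GL [ffun j => u (s j)] * perm_GL F s)%g.
Proof.
apply: eq_GLP => j k; rewrite mul_perm_GL mul_diag_GL diag_GLE perm_GLE ffunE.
by rewrite mulr_natr.
Qed.

Lemma diag_perm_GL s u :
  (diag_GL u * perm_GL F s = perm_GL F s * diag_GL [ffun j => u (s^-1 j)%g])%g.
Proof.
rewrite perm_diag_GL; congr (diag_GL _ * _)%g.
by apply/ffunP=> j; rewrite !ffunE permK.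
Qed.

Lemma perm_GL_conj s g j k :
  GLval (perm_GL F s * g * (perm_GL F s)^-1)%g j k = g (s j) (s k).
Proof. by rewrite -perm_GLV mul_GL_perm invgK mul_perm_GL. Qed.

Lemma mem_diagonals (D : {set {unit F}}) u :
  (forall j, u j \in D) -> diag_GL u \in diagonals n D.
Proof. by move=> Du; apply/imset_f/ffun_onP. Qed.

Lemma diagonalsP (D : {set {unit F}}) g :
  reflect (exists2 u : {ffun _ -> _}, forall j, u j \in D & g = diag_GL u)
    (g \in diagonals n D).
Proof.
apply: (iffP imsetP) => [[u /ffun_onP Du ->]|[u Du ->]]; exists u => //.
exact/ffun_onP.
Qed.

Lemma weylP g : reflect (exists s, g = perm_GL F s) (g \in weyl F n).
Proof. by apply: (iffP imsetP) => [[s _ ->]|[s ->]]; exists s. Qed.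

Lemma mem_weyl s : perm_GL F s \in weyl F n.
Proof. by apply/weylP; exists s. Qed.

Definition upper g := [forall j : 'J, forall k : 'J, (k < j)%N ==> (g j k == 0)].

Lemma upperP g :
  reflect (forall j k, (k < j)%N -> g j k = 0) (upper g).
Proof.
apply: (iffP 'forall_forallP) => upg j k; have := upg j k.
  by move/implyP=> upjk /upjk/eqP.
by move=> upjk; apply/implyP=> /upjk->.
Qed.

Lemma upper_diagM g h j : upper g -> upper h -> GLval (g * h)%g j j = g j j * h j j.
Proof.
move=> /upperP upg /upperP uph; rewrite mul_GLE (bigD1 j) //= big1 ?addr0 // => k.
by rewrite neq_ltn => /orP[/upg->|/uph->]; rewrite ?mul0r ?mulr0.
Qed.

Lemma upperM g h : upper g -> upper h -> upper (g * h)%g.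
Proof.
move=> /upperP upg /upperP uph; apply/upperP=> j k lt_kj.
rewrite mul_GLE big1 // => l _.
have [lt_lj|le_jl] := ltnP l j; first by rewrite upg ?mul0r.
by rewrite uph ?mulr0 // (leq_trans lt_kj).
Qed.

Lemma upper_diag u : upper (diag_GL u : gT).
Proof.
by apply/upperP=> j k lt_kj; rewrite diag_GLE -val_eqE gtn_eqF.
Qed.

Lemma mem_unitriangular g :
  (g \in unitriangular F n) = upper g && [forall j, g j j == 1].
Proof.
rewrite inE; congr (_ && _); apply/is_trig_mxP/upperP=> upg j k lt_jk.
  by have := upg _ _ lt_jk; rewrite mxE.
by rewrite mxE upg.
Qed.

(** Membership is read off the entries, so closure under products and under diagonal conjugation
    needs no manipulation of the two factors. *)
Lemma borelP A g :
  reflect (upper g /\ exists2 u : {ffun _ -> _},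
             forall j, u j \in A & forall j, g j j = val (u j))
    (g \in borel n A).
Proof.
apply: (iffP mulsgP) => [[_ v /diagonalsP[u Au ->]]|[upg [u Au def_u]]].
  rewrite mem_unitriangular => /andP[upv /forallP v1] ->; split.
    exact: upperM (upper_diag u) upv.
  exists u => // j.
  by rewrite (upper_diagM _ (upper_diag u)) // diag_GLE eqxx (eqP (v1 j)) mulr1.
exists (diag_GL u) ((diag_GL u)^-1 * g)%g; rewrite ?mulKVg ?mem_diagonals //.
rewrite -diag_GLV mem_unitriangular upperM ?upper_diag //=.
apply/forallP=> j; rewrite mul_diag_GL ffunE def_u.
by rewrite -FinRing.val_unitM mulVg.
Qed.

Lemma borel_group_set A : group_set (borel n A).
Proof.
apply/group_setP; split=> [|g h /borelP[upg [u Au def_u]] /borelP[uph [v Av def_v]]].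
  apply/borelP; rewrite -diag_GL1; split; first exact: upper_diag.
  by exists [ffun=> 1%g] => j; rewrite ?diag_GLE ?eqxx // ffunE group1.
apply/borelP; split; first exact: upperM.
exists [ffun j => u j * v j]%g => j; first by rewrite ffunE groupM.
by rewrite upper_diagM // ffunE def_u def_v.
Qed.
Canonical borel_group A := Group (borel_group_set A).

Lemma borelM A g h : g \in borel n A -> h \in borel n A -> (g * h)%g \in borel n A.
Proof. exact: (@groupM _ (borel_group A)). Qed.

Lemma borelVE A g : (g^-1 \in borel n A)%g = (g \in borel n A).
Proof. by rewrite (groupV (borel_group A)). Qed.

Lemma diag_borel A u : (forall j, u j \in A) -> diag_GL u \in borel n A.
Proof.
move=> Au; apply/borelP; split; first exact: upper_diag.
by exists u => // j; rewrite diag_GLE eqxx.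
Qed.

Lemma diag_norm_borel A u : diag_GL u \in 'N(borel n A)%g.
Proof.
suffices nB v : (borel n A :^ diag_GL v \subset borel n A)%g by rewrite inE nB.
apply/subsetP=> _ /imsetP[g /borelP[upg [w Aw def_w]] ->]; apply/borelP.
rewrite conjgE -diag_GLV; split; first by rewrite !upperM ?upper_diag.
exists w => // j; rewrite mulgA mul_GL_diag mul_diag_GL def_w ffunE mulrAC.
by rewrite -FinRing.val_unitM mulVg mul1r.
Qed.

Lemma unitriangular_borel A g : g \in unitriangular F n -> g \in borel n A.
Proof.
rewrite mem_unitriangular => /andP[upg /forallP g1]; apply/borelP; split=> //.
by exists [ffun=> 1%g] => j; rewrite ffunE ?group1 // (eqP (g1 j)).
Qed.

(** * Root elements attached to a simple reflection *)

Section RootSubgroup.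
Variable i : 'I_n.-1.
Notation j0 := (widen_ord (leqnSn _) i).
Notation j1 := (lift ord0 i).

Lemma neq_lo_hi : j0 != j1.
Proof. by rewrite -val_eqE /= /bump add1n neq_ltn ltnSn. Qed.

Fact root_GL_subproof (x : F) :
  1 + x *: delta_mx j0 j1 \is a @GRing.unit 'M[F]_n.-1.+1.
Proof.
(* The matrix unit squares to zero, which makes [1 - D] the inverse of [1 + D]. *)
set D := x *: _; apply/unitrP; exists (1 - D); have DD0 : D * D = 0.
  rewrite -scalerAl -scalerAr -[_ * _]/(_ *m _) mul_delta_mx_0 ?scaler0 //.
  by rewrite eq_sym neq_lo_hi.
split; rewrite mulrDl !mulrDr !(mulNr, mulrN) DD0 oppr0 !(mul1r, mulr1) addr0.
  by rewrite addrK.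
by rewrite subrK.
Qed.

Definition root_GL (x : F) : gT := FinRing.unit 'M[F]_n.-1.+1 (root_GL_subproof x).

Lemma root_GLE x j k : root_GL x j k = (j == k)%:R + x *+ ((j == j0) && (k == j1)).
Proof. by rewrite !mxE mulr_natr. Qed.

Lemma mul_root_GL x g j k :
  GLval (root_GL x * g)%g j k = g j k + (x * g j1 k) *+ (j == j0).
Proof.
rewrite mul_GLE; under eq_bigr do rewrite root_GLE mulrDl.
rewrite big_split /= (bigD1 j) //= eqxx mul1r big1 ?addr0 => [|l]; last first.
  by rewrite eq_sym => /negPf->; rewrite mul0r.
congr (_ + _); case: (j == j0) => /=; last by rewrite big1 // => l _; rewrite mul0r.
rewrite (bigD1 j1) //= eqxx big1 ?addr0 // => l /negPf->.
by rewrite mul0r.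
Qed.

Lemma root_unitriangular x : root_GL x \in unitriangular F n.
Proof.
rewrite mem_unitriangular; apply/andP; split; last first.
  apply/forallP=> j; rewrite root_GLE eqxx; case: (j =P j0) => [->|_].
    by rewrite (negPf neq_lo_hi) addr0.
  by rewrite addr0.
apply/upperP=> j k lt_kj; rewrite root_GLE -[j == k]val_eqE gtn_eqF // add0r.
case: eqP => //= def_j; case: eqP => // def_k; move: lt_kj.
by rewrite def_j def_k /= /bump add1n ltnNge leqnSn.
Qed.

Notation s := (simple_refl F i).
Notation tau := (tperm j0 j1).

Lemma refl_GLK : (s * s = 1)%g.
Proof. by rewrite /simple_refl -perm_GLM tperm2 perm_GL1. Qed.

Lemma refl_GLV : (s^-1 = s)%g.
Proof. by apply: (mulIg s); rewrite mulVg refl_GLK. Qed.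

Definition refl_torus (x y : {unit F}) : {ffun 'J -> {unit F}} :=
  [ffun j => if j == j0 then x else if j == j1 then y else 1%g].

(** The rank one identity: in the 2 by 2 block of the indices [j0], [j1], both sides have rows (1,
    -1/x) and (x, 0); elsewhere both are the identity. *)
Lemma refl_root_GL (x : {unit F}) :
  (s * root_GL (val x) * s * root_GL (- (val x)^-1)%R
    = root_GL (val x)^-1%R * s * diag_GL (refl_torus x (unitN1 F * x^-1)))%g.
Proof.
have x0 : val x != 0 by rewrite -unitfE (valP x).
have ne01 := negPf neq_lo_hi; have ne10 : (j1 == j0) = false by rewrite eq_sym.
apply: eq_GLP => j k; rewrite -!mulgA mul_root_GL !mul_perm_GL mul_root_GL !mul_perm_GL.
rewrite tpermK tpermR !diag_GLE !root_GLE !ffunE !eqxx /=.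
have [->|ne_j0] := eqVneq j j0.
  rewrite !tpermL ne10 eqxx /= addr0 mulrnAr mulVf // addrC [j1 == k]eq_sym.
  by rewrite mulN1r.
have [->|ne_j1] := eqVneq j j1.
  rewrite !tpermR eqxx /= mulr0n mulr1n !addr0 mulrDr mulr_natr mulrnAr mulrN.
  by rewrite mulfV // addrCA [j1 == k]eq_sym mulNrn subrr addr0.
rewrite tpermD 1?eq_sym // (negPf ne_j0) (negPf ne_j1) /=.
by rewrite mulr0n !addr0.
Qed.

(** The parameter of the root element split off on the left of [b]. Dividing by the diagonal entry
    makes left translation by root elements act additively. *)
Definition root_coord (b : gT) : F := b j0 j1 / b j1 j1.

Lemma root_coordM y (b : gT) :
  b j1 j1 != 0 -> root_coord (root_GL y * b)%g = y + root_coord b.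
Proof.
move=> nz_b; rewrite /root_coord !mul_root_GL eqxx eq_sym (negPf neq_lo_hi) addr0.
by rewrite mulrDl mulfK // addrC.
Qed.

Lemma borel_diag_neq0 A (b : gT) j : b \in borel n A -> b j j != 0.
Proof. by case/borelP=> _ [u _ ->]; rewrite -unitfE (valP (u j)). Qed.

(** The only entry that conjugation by [s] carries below the diagonal is the one at [(j0, j1)], and
    it vanishes by hypothesis. *)
Lemma refl_conj_borel A (b : gT) :
  b \in borel n A -> root_coord b = 0 -> (s * b * s)%g \in borel n A.
Proof.
move=> Bb /eqP; rewrite mulf_eq0 invr_eq0 (negPf (borel_diag_neq0 _ Bb)) orbF.
move=> /eqP b01; have /borelP[/upperP upb [u Au def_u]] := Bb.
apply/borelP; rewrite -{2 4}refl_GLV; split; last first.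
  by exists [ffun j => u (tau j)] => j; rewrite ?perm_GL_conj ffunE.
apply/upperP=> j k lt_kj; rewrite perm_GL_conj.
have [lt_t|[-> ->]] := tau_lt i lt_kj; first exact: upb.
by rewrite tpermL tpermR.
Qed.

(* Left translation by [root_GL x] permutes [D] and shifts [root_coord] by [x]. *)
Lemma sum_root_coord (V : zmodType) A (D : {set gT}) (f : F -> V) :
    {subset D <= borel n A} ->
    (forall x, {in D, forall b, root_GL x * b \in D}%g) ->
  (\sum_(b in D) f (root_coord b)) *+ #|F| = (\sum_x f x) *+ #|D|.
Proof.
(* Double counting: for fixed [b] the shift reindexes the sum over [x]; for fixed [x] it is undone
   by translating [D]. *)
move=> sDB rootD; transitivity (\sum_x \sum_(b in D) f (x + root_coord b)); last first.
  rewrite exchange_big /= -sumr_const; apply: eq_bigr => b _.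
  by rewrite [RHS](reindex_inj (addIr (root_coord b))).
rewrite -sumr_const; apply: eq_bigr => x _.
have rootDE : (root_GL x *: D = D)%g.
  apply/eqP; rewrite eqEcard card_lcoset leqnn andbT.
  by apply/subsetP=> _ /lcosetP[b Db ->]; apply: rootD.
transitivity (\sum_(b in (root_GL x *: D)%g) f (root_coord b)); first by rewrite rootDE.
rewrite -lcosetE big_imset /= => [|b c _ _]; last exact: mulgI.
by apply: eq_bigr => b Db; rewrite root_coordM // (borel_diag_neq0 _ (sDB b Db)).
Qed.

(** Conjugation moves the off-diagonal entry to [(w^-1 j0, w^-1 j1)], which the ascent puts above
    the diagonal. *)
Lemma root_GL_perm_conj (x : F) (w : {perm 'J}) :
    ((w^-1 j0)%g < (w^-1 j1)%g)%N ->
  (perm_GL F w * root_GL x * (perm_GL F w)^-1)%g \in unitriangular F n.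
Proof.
move=> lt_w; have /andP[] : upper (root_GL x) && [forall j, root_GL x j j == 1].
  by rewrite -mem_unitriangular root_unitriangular.
move=> _ /forallP r1; rewrite mem_unitriangular; apply/andP; split; last first.
  by apply/forallP=> j; rewrite perm_GL_conj r1.
apply/upperP=> j k lt_kj; rewrite perm_GL_conj root_GLE (inj_eq perm_inj).
rewrite -[j == k]val_eqE gtn_eqF // add0r.
case: eqP => //= def_j; case: eqP => // def_k; move: lt_kj lt_w.
by rewrite -def_j -def_k !permK => /ltnW; rewrite leqNgt => /negPf->.
Qed.

End RootSubgroup.
End MatrixGroups.

(** * Word length in the Weyl group as a number of inversions *)

Section WeylLength.
Variables (F : finFieldType) (n : nat).
Notation gT := {'GL_n[F]}.
Notation "''J'" := 'I_n.-1.+1.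
Implicit Types (s : {perm 'J}) (i : 'I_n.-1).
Notation lo i := (widen_ord (leqnSn _) i).
Notation hi i := (lift ord0 i).
Notation tau i := (tperm (lo i) (hi i)).
Notation S := [set simple_refl F i | i : 'I_n.-1].
Notation linv s := #|inversions s^-1%g|.

(** Inversions are counted on the inverse because it turns right multiplication by [tau i] into left
    multiplication. *)
Lemma card_inversions_ascent s i : ((s^-1 (lo i))%g < (s^-1 (hi i))%g)%N ->
  linv (s * tau i)%g = (linv s).+1.
Proof. by move=> asc_s; rewrite invMg tpermV card_inversions_tau. Qed.

Lemma card_inversions_descent s i : ((s^-1 (hi i))%g < (s^-1 (lo i))%g)%N ->
  linv s = (linv (s * tau i)%g).+1.
Proof.
move=> desc_s; have := @card_inversions_ascent (s * tau i)%g i.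
by rewrite -mulgA tperm2 mulg1 => <- //; rewrite invMg tpermV !permM tpermL tpermR.
Qed.

(** Induction along reduced words: a permutation without descents is the identity, and removing a
    descent on the right lowers the number of inversions by one. *)
Lemma perm_ascent_ind (Q : {perm 'J} -> Prop) : Q 1%g ->
    (forall s i, (s^-1 (lo i))%g < (s^-1 (hi i))%g -> Q s -> Q (s * tau i)%g)%N ->
  forall s, Q s.
Proof.
move=> Q1 Qs s; move: {2}(linv s) (erefl (linv s)) => k.
elim: k s => [|k IHk] s def_k.
  suffices -> : s = 1%g by [].
  apply: invg_inj; rewrite invg1; apply: perm_ascents_eq1 => i.
  case: ltngtP => [//|desc|/eqP]; last by rewrite perm_lo_hi_neq.
  by move: def_k; rewrite (card_inversions_descent desc).
have [asc|] := boolP [forall i : 'I_n.-1, (s^-1 (lo i))%g < (s^-1 (hi i))%g]%N.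
  have s1 : s^-1%g = 1%g by apply: perm_ascents_eq1 => i; apply/forallP: i.
  by move: def_k; rewrite s1 inversions1 cards0.
case/forallPn=> i; rewrite -leqNgt leq_eqVlt eq_sym perm_lo_hi_neq /= => desc.
have := def_k; rewrite (card_inversions_descent desc) => -[def_k'].
rewrite -[s](mulgK (tau i)) tpermV; apply: Qs (IHk _ def_k').
by rewrite invMg tpermV !permM tpermL tpermR.
Qed.

Lemma perm_GL_word s : perm_GL F s \in (S ^+ (linv s))%g.
Proof.
elim/perm_ascent_ind: s => [|s i asc IHs].
  by rewrite invg1 inversions1 cards0 perm_GL1 expg0 set11.
rewrite card_inversions_ascent // expgSr perm_GLM; apply: mem_mulg IHs _.
exact: imset_f.
Qed.

(** Each letter changes the number of inversions by exactly one, up or down, so no word is shorter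
    than that number. *)
Lemma word_inversions k s : perm_GL F s \in (S ^+ k)%g -> (linv s <= k)%N.
Proof.
elim: k s => [|k IHk] s.
  rewrite expg0 => /set1P; rewrite -perm_GL1 => /perm_GL_inj->.
  by rewrite invg1 inversions1 cards0.
rewrite expgSr => /mulsgP[w _ Sw /imsetP[i _ ->] def_s].
have def_w : w = perm_GL F (s * tau i)%g.
  by rewrite perm_GLM def_s -mulgA refl_GLK mulg1.
have := IHk (s * tau i)%g; rewrite -def_w => /(_ Sw) le_k.
have [asc|desc|/eqP] := ltngtP (s^-1 (lo i))%g (s^-1 (hi i))%g.
- by rewrite ltnW // -(card_inversions_ascent asc) (leq_trans le_k).
- by rewrite (card_inversions_descent desc).
by rewrite perm_lo_hi_neq.
Qed.

Lemma weyl_lengthE s : weyl_length (perm_GL F s) = linv s.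
Proof.
(* The length is a match on a proof of membership; this eliminates the match, the dummy branch being
   excluded because simple reflections generate. *)
have reflect_val (P : Prop) (c : bool) (r : reflect P c) (f : P -> nat) (k : nat) :
    c -> (forall p, f p = k) -> (if r is ReflectT p then f p else 0%N) = k.
  by case: r.
apply: reflect_val => [|gen_s].
  apply: subsetP (perm_GL_word s); elim: #|_| => [|k IHk]; first exact: sub1G.
  by rewrite expgS mul_subG ?subset_gen.
case: ex_minnP => k Sk min_k; apply/eqP.
by rewrite eqn_leq min_k ?perm_GL_word ?word_inversions.
Qed.

End WeylLength.

(** The double coset is a translate of the product of the two subgroups [B :^ x] and [B], to which
    the product formula applies. *)
Lemma card_dcoset (gT : finGroupType) (B : {group gT}) (x : gT) :
  (#|(B :* x * B)%g| * #|(B :^ x :&: B)%g| = #|B| * #|B|)%N.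
Proof.
have -> : (B :* x * B = x *: (B :^ x * B))%g.
  by rewrite conjsgE !mulgA mulg_set1 mulgV mul1g.
by rewrite card_lcoset -mul_cardG cardJg.
Qed.

Lemma unit_mulgC (R : finComUnitRingType) (x y : {unit R}) : (x * y = y * x)%g.
Proof. by apply: val_inj; rewrite !FinRing.val_unitM mulrC. Qed.

(** * Sizes of double cosets and the Bruhat decomposition *)

Section Bruhat.
Variables (F : finFieldType) (n : nat).
Notation gT := {'GL_n[F]}.
Notation "''J'" := 'I_n.-1.+1.
Implicit Types (A D : {group {unit F}}) (i : 'I_n.-1) (j k : 'J).
Implicit Types (w : {perm 'J}) (g b : gT).
Notation lo i := (widen_ord (leqnSn _) i).
Notation hi i := (lift ord0 i).
Notation s i := (simple_refl F i).
Notation P := (@perm_GL F n).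
Notation ascent w i := ((w^-1 (lo i))%g < (w^-1 (hi i))%g)%N.

Lemma mem_borel_conj A w g :
  (g \in borel n A :^ P w)%g = (P w * g * (P w)^-1 \in borel n A)%g.
Proof. by rewrite mem_conjg conjgE invgK mulgA. Qed.

(** At an ascent the intersection on the left is stable under translation by root elements, so
    [root_coord] takes each value equally often on it. The fibre over 0 is the conjugate by [s i] of
    the intersection on the right. *)
Lemma card_borel_conj_refl A w i : ascent w i ->
  #|borel n A :^ P w :&: borel n A|%g
    = (#|F| * #|borel n A :^ (P w * s i) :&: borel n A|%g)%N.
Proof.
move=> asc; set D := (_ :&: _)%g.
have sDB : {subset D <= borel n A} by move=> b /setIP[].
have rootD x : {in D, forall b, root_GL i x * b \in D}%g.
  move=> b /setIP[Bwb Bb]; apply/setIP; split; last first.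
    exact: borelM (unitriangular_borel _ (root_unitriangular _ _)) Bb.
  apply: groupM Bwb.
  by rewrite mem_borel_conj unitriangular_borel // root_GL_perm_conj.
(* The indicator function of 0 counts the fibre. *)
have := sum_root_coord (fun x => (x == 0)%:R : int) sDB rootD.
have -> : \sum_(x : F) (x == 0%R)%:R = 1 :> int.
  by rewrite (bigD1 0) //= eqxx big1 ?addr0 // => x /negPf->.
have -> : \sum_(b in D) (root_coord i b == 0%R)%:R
    = #|[set b in D | root_coord i b == 0%R]|%:R :> int.
  rewrite -sum1_card natr_sum; under [RHS]eq_bigl do rewrite inE.
  by rewrite big_mkcondr; apply: eq_bigr => b _; case: (_ == 0).
rewrite -mulrnA => /eqP; rewrite Num.Theory.eqr_nat => /eqP <-.
rewrite mulnC; congr (_ * _)%N; rewrite -[RHS](cardJg _ (s i)).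
apply: eq_card => b; rewrite conjIg -conjsgM -mulgA refl_GLK mulg1 !inE.
have sJ c : (c \in borel n A :^ s i)%g = (s i * c * s i \in borel n A)%g.
  by rewrite -{3}refl_GLV; apply: mem_borel_conj.
rewrite sJ -andbA; apply: andb_id2l => Bwb; apply/andP/idP => [[Bb /eqP b0]|Bsb].
  exact: refl_conj_borel.
have sE (c : gT) j k : GLval (s i * c * s i)%g j k
    = c (tperm (lo i) (hi i) j) (tperm (lo i) (hi i) k).
  by rewrite -{2}refl_GLV perm_GL_conj.
(* Upper triangularity of [b] itself is not yet known: this entry vanishes because [b] lies in the
   conjugate by [w] and [w] has an ascent at [i]. *)
have b10 : GLval b (hi i) (lo i) = 0.
  move: Bwb; rewrite mem_borel_conj => /borelP[/upperP/(_ _ _ asc)].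
  by rewrite perm_GL_conj !permKV.
have defb : b = (s i * (s i * b * s i) * s i)%g.
  by rewrite !mulgA refl_GLK mul1g -mulgA refl_GLK mulg1.
split.
  rewrite defb refl_conj_borel //.
  by rewrite /root_coord !sE tpermL tpermR b10 mul0r.
rewrite defb /root_coord sE tpermL tpermR; have /borelP[/upperP-> //] := Bsb.
  by rewrite mul0r.
Qed.

Lemma card_dcoset_refl A w i : ascent w i ->
  #|borel n A :* (P w * s i) * borel n A|%g
    = (#|F| * #|borel n A :* P w * borel n A|%g)%N.
Proof.
move=> asc; have c0 : (0 < #|borel n A :^ (P w * s i) :&: borel n A|%g)%N.
  by rewrite cardG_gt0.
apply/eqP; rewrite -(eqn_pmul2r c0) card_dcoset -mulnA mulnCA.
by rewrite -card_borel_conj_refl // card_dcoset.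
Qed.

Lemma borel_root_decomp A i b : b \in borel n A ->
  exists2 c, c \in borel n A /\ root_coord i c = 0
            & b = (root_GL i (root_coord i b) * c)%g.
Proof.
move=> Bb; pose r := root_GL i (root_coord i b); exists (r^-1 * b)%g; last first.
  by rewrite mulKVg.
have Br : r \in borel n A := unitriangular_borel A (root_unitriangular i _).
have Bc : (r^-1 * b)%g \in borel n A by apply: borelM => //; rewrite borelVE.
split=> //; apply: (addrI (root_coord i b)); rewrite addr0 -root_coordM ?mulKVg //.
exact: borel_diag_neq0 Bc.
Qed.

(** Split [b] into a root element and a factor of root coordinate 0: the first moves left across
    [w], the second right across [s i]. *)
Lemma ascent_step A w i b : ascent w i -> b \in borel n A ->
  exists c d, [/\ c \in borel n A, d \in borel n A
             & P w * b * s i = c * (P w * s i) * d]%g.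
Proof.
move=> asc Bb; have [c [Bc c0] def_b] := borel_root_decomp i Bb.
exists (P w * root_GL i (root_coord i b) * (P w)^-1)%g, (s i * c * s i)%g.
split; first exact/unitriangular_borel/root_GL_perm_conj.
  exact: refl_conj_borel.
rewrite {1}def_b !mulgA mulgKV -!mulgA; congr (_ * (_ * _))%g.
by rewrite (mulgA (s i) (s i)) refl_GLK mul1g.
Qed.

(** The rank one identity rewrites the root element of [b]; the remaining factor crosses [s i]. *)
Lemma refl_step A i b (x : {unit F}) : b \in borel n A -> root_coord i b = val x ->
  exists c d, [/\ c \in borel n A, d \in borel n A
    & s i * b * s i
      = c * (s i * diag_GL (refl_torus i x (unitN1 F * x^-1))) * d]%g.
Proof.
move=> Bb xE; have [c [Bc c0] def_b] := borel_root_decomp i Bb.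
exists (root_GL i (val x)^-1), ((root_GL i (- (val x)^-1)%R)^-1 * (s i * c * s i))%g.
split; first exact/unitriangular_borel/root_unitriangular.
  apply: borelM (refl_conj_borel Bc c0); rewrite borelVE.
  exact/unitriangular_borel/root_unitriangular.
rewrite !mulgA -refl_root_GL mulgK {1}def_b xE -!mulgA; congr (_ * (_ * _))%g.
by rewrite (mulgA (s i) (s i)) refl_GLK mul1g.
Qed.

Lemma weyl_ascent w i : ascent w i \/ ascent (w * tperm (lo i) (hi i))%g i.
Proof.
have [asc|desc|/eqP] := ltngtP (w^-1 (lo i))%g (w^-1 (hi i))%g; first by left.
  by right; rewrite invMg tpermV !permM tpermL tpermR.
by rewrite perm_lo_hi_neq.
Qed.

Notation FB := (borel n [set: {unit F}]).
(** The union of all Bruhat cells. Stability under right multiplication by upper triangular and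
    permutation matrices will show that it is the whole group. *)
Let bigcell : {set gT} := (FB * weyl F n * FB)%g.

Let bigcellP g : reflect (exists b w c, [/\ b \in FB, c \in FB & g = b * P w * c]%g)
  (g \in bigcell).
Proof.
apply: (iffP mulsgP) => [[_ c /mulsgP[b _ Bb /weylP[w ->] ->] Bc ->]|].
  by exists b, w, c.
case=> b [w [c [Bb Bc ->]]]; exists (b * P w)%g c => //.
by rewrite mem_mulg ?mem_weyl.
Qed.

Let bigcell_borel g b : g \in bigcell -> b \in FB -> (g * b)%g \in bigcell.
Proof.
case/bigcellP=> c [w [d [Bc Bd ->]]] Bb; apply/bigcellP; exists c, w, (d * b)%g.
by split; [| apply: borelM | rewrite !mulgA].
Qed.

Let bigcell_refl g i : g \in bigcell -> (g * s i)%g \in bigcell.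
Proof.
case/bigcellP=> b [w [c [Bb Bc ->]]]; apply/bigcellP.
have [asc|asc] := weyl_ascent w i.
  have [d [d' [Bd Bd' def_wcs]]] := ascent_step asc Bc.
  exists (b * d)%g, (w * tperm (lo i) (hi i))%g, d'; split=> //; first exact: borelM.
  by rewrite -!mulgA (mulgA (P w)) def_wcs perm_GLM !mulgA.
set w' := (w * _)%g in asc.
have def_w : P w = (P w' * s i)%g by rewrite perm_GLM -mulgA refl_GLK mulg1.
(* At a descent [w = w' s]. If the root coordinate of [c] is 0, then [s c s] is upper triangular and
   the product lies in the cell of [w']; otherwise the rank one identity returns it to the cell of
   [w]. *)
have [c0|nz_c] := eqVneq (root_coord i c) 0.
  exists b, w', (s i * c * s i)%g; split; rewrite ?refl_conj_borel //.
  by rewrite def_w !mulgA.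
have uc : root_coord i c \is a GRing.unit by rewrite unitfE.
pose x := FinRing.unit F uc.
have [d [d' [Bd Bd' def_scs]]] := refl_step (x := x) Bc (erefl _).
have [e [e' [Be Be' def_wds]]] := ascent_step asc Bd.
set h := diag_GL _ in def_scs; have Bh : h \in FB by apply: diag_borel => j; rewrite inE.
exists (b * e)%g, w, (e' * h * d')%g; split; first exact: borelM.
  exact: borelM (borelM Be' Bh) Bd'.
have def_wcs : (P w * c * s i = P w' * (s i * c * s i))%g by rewrite def_w !mulgA.
rewrite -!mulgA !(mulgA (P w)) def_wcs def_scs !mulgA; congr (_ * _ * _)%g.
by rewrite -!(mulgA b) def_wds -def_w !mulgA.
Qed.

Let bigcell_perm g w : g \in bigcell -> (g * P w)%g \in bigcell.
Proof.
elim/perm_ascent_ind: w => [|w i _ IHw] Mg; first by rewrite perm_GL1 mulg1.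
by rewrite perm_GLM mulgA bigcell_refl ?IHw.
Qed.

Lemma upper_borel g : upper g -> g \in FB.
Proof.
move=> upg; apply/borelP; split=> //.
have g0 j : GLval g j j \is a GRing.unit.
  have : \det (GLval g)^T \is a GRing.unit.
    by rewrite det_tr -unitmxE; apply: (valP g).
  rewrite det_trig => [|]; last first.
    by apply/is_trig_mxP=> k l lt_kl; rewrite mxE; have /upperP-> := upg.
  by rewrite (bigD1 j) //= mxE unitrM => /andP[].
by exists [ffun j => FinRing.unit F (g0 j)] => j; rewrite ?inE ?ffunE.
Qed.

(** The LUP factorisation writes [g] as a permutation matrix times a lower and an upper triangular
    factor; once the lower one is conjugated, [g] is a product of permutation and upper triangular
    matrices. *)
Lemma full_bruhat g : exists b w c, [/\ b \in FB, c \in FB & g = b * P w * c]%g.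
Proof.
apply/bigcellP; have := cormen_lup_correct (GLval g).
have := cormen_lup_perm (GLval g); have := @cormen_lup_lower _ _ (GLval g).
have := @cormen_lup_upper _ _ (GLval g); have := cormen_lup_detL (GLval g).
case: cormen_lup => [[_ L] U] /= detL upU loL /is_perm_mxP[p ->] def_g.
have uL : L \is a GRing.unit by rewrite -[_ \is a _]/(L \in unitmx) unitmxE detL unitr1.
have uU : U \is a GRing.unit.
  by rewrite -(unitrMr _ uL) -def_g unitrMr ?(valP g) //; apply: unitmx_perm.
pose l : gT := FinRing.unit _ uL; pose u : gT := FinRing.unit _ uU.
have -> : g = (P p^-1%g * l * u)%g.
  apply: (mulgI (P p)); rewrite !mulgA -perm_GLM mulgV perm_GL1 mul1g.
  exact: val_inj.
(* The longest permutation conjugates the lower triangular factor into [FB]. *)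
pose w0 := perm (@rev_ord_inj n.-1.+1).
have Bu : u \in FB by apply/upper_borel/upperP=> j k /upU.
pose l' := (P w0 * l * (P w0)^-1)%g; have Bl' : l' \in FB.
  apply/upper_borel/upperP=> j k lt_kj; rewrite perm_GL_conj !permE.
  have lt_rev : (rev_ord j < rev_ord k)%N.
    by rewrite /= ltn_sub2l // ltnS (leq_trans lt_kj) ?leq_ord.
  by rewrite [LHS]loL ?(ltnW lt_rev) // -val_eqE ltn_eqF.
have -> : (P p^-1 * l * u = P p^-1 * (P w0)^-1 * l' * P w0 * u)%g.
  by rewrite /l' !mulgA !mulgKV.
apply: bigcell_borel Bu; apply: bigcell_perm; apply: bigcell_borel Bl'.
rewrite -perm_GLV; apply: bigcell_perm; apply/bigcellP; exists 1%g, p^-1%g, 1%g.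
by rewrite !group1 mul1g mulg1.
Qed.

Lemma bruhat_cover A D g : (A * D)%g = setT ->
  exists x b c, [/\ x \in weyl F n * diagonals n D, b \in borel n A,
                    c \in borel n A & g = b * x * c]%g.
Proof.
move=> defAD; have [b [w [c [Bb Bc ->]]]] := full_bruhat g.
(* Factoring the inverse of [b] leaves its torus part next to [P w]. *)
move: Bb; rewrite -borelVE => /mulsgP[_ b' /diagonalsP[u _ ->] Ub' def_b].
have /mulsgP[_ c' /diagonalsP[v _ ->] Uc' ->] := Bc.
(* The combined torus part once that of [b] has crossed [w]. Its component in [A] goes back across
   [w] into the left Borel factor, and its component in [D] stays in the representative. *)
pose t j := ((u (w^-1 j)%g)^-1 * v j)%g.
have /all_sig2[p Ap] j : {p | (p.1 \in A) && (p.2 \in D) & t j == (p.1 * p.2)%g}.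
  apply: sig2W; have : t j \in (A * D)%g by rewrite defAD inE.
  by case/mulsgP=> y z Ay Dz ->; exists (y, z); rewrite //= Ay.
move=> def_t; pose ta := [ffun j => (p j).1]; pose td := [ffun j => (p j).2].
pose ta' := [ffun j => ta (w j)].
exists (P w * diag_GL td)%g, (b'^-1 * diag_GL ta')%g, c'; split.
- by rewrite mem_mulg ?mem_weyl ?mem_diagonals // => j; rewrite ffunE; case/andP: (Ap j).
- apply: borelM; first by rewrite borelVE unitriangular_borel.
  by apply: diag_borel => j; rewrite !ffunE; case/andP: (Ap (w j)).
- exact: unitriangular_borel.
have -> : b = (b'^-1 * (diag_GL u)^-1)%g by rewrite -invMg -def_b invgK.
rewrite -!mulgA; congr (_ * _)%g; rewrite -diag_GLV !mulgA
  -(perm_diag_GL w ta) diag_perm_GL; congr (_ * _)%g.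
rewrite -!mulgA -!diag_GLM; congr (_ * diag_GL _)%g; apply/ffunP=> j.
by rewrite !ffunE -(eqP (def_t j)).
Qed.

(* Comparing entries of [b x = y c], with [b] and [c] upper triangular, gives
   [t j <= s j] for the underlying permutations, whence [s = t]. *)
Lemma bruhat_inj A D : A :&: D = 1%g ->
  {in (weyl F n * diagonals n D)%g &, forall x y,
     x \in (borel n A :* y * borel n A)%g -> x = y}.
Proof.
move=> tiAD x y /mulsgP[x1 x2 /weylP[s def_x1] /diagonalsP[u Du def_x2] ->{x}].
case/mulsgP=> y1 y2 /weylP[t def_y1] /diagonalsP[v Dv def_y2] ->{y}.
rewrite {x1}def_x1 {x2}def_x2 {y1}def_y1 {y2}def_y2.
case/mulsgP=> _ c /rcosetP[b Bb ->] Bc def_x.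
have {}def_x : (b^-1 * (P s * diag_GL u) = P t * diag_GL v * c)%g.
  by rewrite def_x -!mulgA mulKg.
have {}Bb : b^-1%g \in borel n A by rewrite borelVE.
move: {b}(b^-1)%g Bb def_x => b Bb def_x.
have eq_jk j k : GLval b j (s^-1 k)%g * val (u k) = val (v (t j)) * GLval c (t j) k.
  have := congr1 (fun g : gT => g j k) def_x.
  by rewrite mulgA mul_GL_diag mul_GL_perm -mulgA mul_perm_GL mul_diag_GL.
have [/upperP upb [y Ay def_y]] := borelP _ _ Bb.
have [/upperP upc [z Az def_z]] := borelP _ _ Bc.
have eq_st : s = t.
  apply: (mulgI t^-1%g); rewrite mulVg; apply: perm_le_eq1 => j; rewrite permM leqNgt.
  apply/negP=> lt_sj; have := eq_jk (t^-1 j)%g (s (t^-1 j))%g.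
  rewrite permK permKV (upc _ _ lt_sj) mulr0 def_y => /eqP.
  apply/negP/mulf_neq0; rewrite -unitfE; first exact: (valP (y _)).
  exact: (valP (u _)).
rewrite eq_st; congr (_ * diag_GL _)%g; apply/ffunP=> j.
have := eq_jk (t^-1 j)%g j; rewrite -eq_st permKV def_y def_z -!FinRing.val_unitM.
(* The quotient lies in [D] as a quotient of entries of the representatives, and in [A] as a
   quotient of diagonal entries of Borel elements. *)
move/val_inj => eq_yz; suffices : (u j * (v j)^-1)%g \in (A :&: D)%g.
  by rewrite tiAD => /set1P/eqP; rewrite -eq_mulgV1 => /eqP.
rewrite inE [X in _ && X]groupM ?groupV // andbT.
have -> : (u j * (v j)^-1 = (y (s^-1 j))^-1 * z j)%g.
  apply: (mulgI (y (s^-1 j)%g)); rewrite mulgA eq_yz mulKVg.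
  by rewrite (unit_mulgC (v j)) mulgK.
by rewrite groupM ?groupV.
Qed.

End Bruhat.

Lemma idem_mul_idem (K : fieldType) (gT : finGroupType) (B : {group gT}) x y :
  let e := #|B|%:R^-1 *: gsum K B in
  e *m gelt K x *m e *m gelt K y *m e
    = #|B|%:R^-1 *: \sum_(b in B) e *m gelt K (x * b * y)%g *m e.
Proof.
move=> e; have mid X Y : X *m e *m Y = #|B|%:R^-1 *: \sum_(b in B) X *m gelt K b *m Y.
  by rewrite -scalemxAr -scalemxAl mulmx_sumr mulmx_suml.
by rewrite -mulmxA mid; congr (_ *: _); apply: eq_bigr => b _; rewrite !geltM !mulmxA.
Qed.

(** * The relations among the [T x] *)

Section HeckeAlgebra.
Variables (K : fieldType) (F : finFieldType) (n : nat) (Fa Fb : {group {unit F}}).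
Hypotheses (charK : [pchar K] =i pred0) (dprodF : (Fa \x Fb)%g = [set: {unit F}]).
Hypothesis coFab : coprime #|Fa| #|Fb|.

Notation gT := {'GL_n[F]}.
Notation "''J'" := 'I_n.-1.+1.
Implicit Types (i : 'I_n.-1) (w : {perm 'J}) (d x y g : gT).
Notation lo i := (widen_ord (leqnSn _) i).
Notation hi i := (lift ord0 i).
Notation s i := (simple_refl F i).
Notation P := (@perm_GL F n).
Notation ascent w i := ((w^-1 (lo i))%g < (w^-1 (hi i))%g)%N.
Notation Hb := (diagonals n Fb).
Notation W := (weyl F n).
Notation B := (borel n Fa).
Notation e := (hecke_idem K n Fa).
Notation T := (@hecke_T K F n Fa).
Notation H := (hecke K n Fa).
Notation gelt := (gelt K).

Lemma hecke_TE x :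
  T x = (#|(B :* x * B)%g|%:R / #|B|%:R) *: (e *m gelt x *m e).
Proof. exact: (dcoset_sumE (borel_group n Fa) charK). Qed.

Lemma hecke_T1 : T 1%g = e.
Proof. exact: (dcoset_sum1 K (borel_group n Fa)). Qed.

Let ee : e *m e = e := idem_idem (borel_group n Fa) charK.
Let eT x : e *m T x = T x := idem_dcoset_sum (borel_group n Fa) charK x.
Let Te x : T x *m e = T x := dcoset_sum_idem (borel_group n Fa) charK x.
Let nB d : d \in Hb -> d \in 'N(borel_group n Fa)%g.
Proof. by case/diagonalsP=> u _ ->; apply: diag_norm_borel. Qed.

Lemma hecke_T_diagL d x : d \in Hb -> T d *m T x = T (d * x)%g.
Proof. by move/nB=> nBd; apply: (mul_norm_dcoset_sum charK). Qed.

Lemma hecke_T_diagR d x : d \in Hb -> T x *m T d = T (x * d)%g.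
Proof. by move/nB=> nBd; apply: (mul_dcoset_sum_norm charK). Qed.

Let F_neq0 : #|F|%:R != 0 :> K.
Proof. by rewrite (natr_card_neq0 (x := 0) charK). Qed.
Let B_neq0 : #|B|%:R != 0 :> K.
Proof. by rewrite (natr_card_neq0 (x := 1%g) charK) ?(group1 (borel_group n Fa)). Qed.

Lemma card_dcoset_simple i : #|(B :* s i * B)%g| = (#|F| * #|B|)%N.
Proof.
have := @card_dcoset_refl F n Fa 1%g i; rewrite invg1 !perm1 => /(_ (lo_lt_hi i)).
by rewrite perm_GL1 mul1g rcoset1 (mulGid (borel_group n Fa)).
Qed.

Lemma hecke_T_simple i : T (s i) = #|F|%:R *: (e *m gelt (s i) *m e).
Proof. by rewrite hecke_TE card_dcoset_simple natrM mulfK. Qed.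

Lemma hecke_T_ascent w i : ascent w i -> T (P w) *m T (s i) = T (P w * s i)%g.
Proof.
move=> asc; rewrite hecke_T_simple !hecke_TE (card_dcoset_refl Fa asc).
rewrite natrM -scalemxAl -scalemxAr scalerA -!mulmxA (mulmxA e e) ee !mulmxA.
rewrite (idem_mul_idem K (borel_group n Fa)).
rewrite (eq_bigr (fun=> e *m gelt (P w * s i)%g *m e)) => [|b Bb]; last first.
  have [c [d [Bc Bd ->]]] := ascent_step asc Bb.
  exact: (@idem_mul_dcoset _ _ (borel_group n Fa)).
rewrite sumr_const -(scaler_nat _ (_ *m e)) !scalerA. congr (_ *: _).
by rewrite mulfVK // mulrAC (mulrC #|F|%:R).
Qed.

Lemma h2E b i z :
  h2 b (lo i) (hi i) z = diag_GL (refl_torus i z (unitN1 F ^+ (b - 1) * z^-1)%g).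
Proof.
rewrite /h2 /h1 -diag_GLM; congr diag_GL; apply/ffunP=> j; rewrite !ffunE.
have [->|_] := eqVneq j (lo i); last by rewrite mul1g.
by rewrite (negPf (neq_lo_hi i)) mulg1.
Qed.

Lemma unitN1K : (unitN1 F * unitN1 F = 1)%g.
Proof. by apply: val_inj; rewrite FinRing.val_unitM /= mulrNN mulr1. Qed.

(** The power kills the component in [Fb]. It is needed for [x = -1], to absorb a sign into
    [B_a]. *)
Lemma expg_card_mem (x : {unit F}) : (x ^+ #|Fb|)%g \in Fa.
Proof.
have [y [z [Fay Fbz -> _]]] := mem_dprod dprodF (in_setT x).
rewrite expgMn; last exact: unit_mulgC.
by rewrite (expg_cardG Fbz) mulg1 groupX.
Qed.

(** The sign splits as -1 = (-1)^b (-1)^(b-1). The second factor is the one built into [X_s]; the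
    first joins [y] in a matrix that lies in [H_a] when [y] is in [F_a]. *)
Lemma refl_torus_dprod i (y z : {unit F}) :
  diag_GL (refl_torus i (y * z) (unitN1 F * (y * z)^-1))%g
    = (diag_GL (refl_torus i y (unitN1 F ^+ #|Fb| * y^-1))
        * h2 #|Fb| (lo i) (hi i) z)%g.
Proof.
rewrite h2E -diag_GLM; congr diag_GL; apply/ffunP=> j; rewrite !ffunE.
case: (j == lo i) => //; case: (j == hi i); last by rewrite mulg1.
have N1E : (unitN1 F ^+ #|Fb| * unitN1 F ^+ (#|Fb| - 1) = unitN1 F)%g.
  case: #|Fb| (cardG_gt0 Fb) => // k _; rewrite subn1 /= expgS -mulgA.
  by rewrite -expgMn ?unitN1K ?expg1n ?mulg1 //; apply: unit_mulgC.
rewrite -{1}N1E invMg (unit_mulgC z^-1%g) !mulgA; congr (_ * _)%g.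
by rewrite -!mulgA; congr (_ * _)%g; apply: unit_mulgC.
Qed.

Lemma hecke_T_simple_diag i u :
  T (s i * diag_GL u)%g = #|F|%:R *: (e *m gelt (s i * diag_GL u)%g *m e).
Proof.
have nBu := diag_norm_borel Fa u.
rewrite -[LHS](mul_dcoset_sum_norm charK _ nBu) (dcoset_sum_norm _ nBu).
rewrite [X in X *m _]hecke_T_simple.
rewrite -scalemxAl geltM; congr (_ *: _).
by rewrite (norm_idem _ nBu) !mulmxA -(mulmxA _ e e) ee -!mulmxA -(norm_idem _ nBu).
Qed.

(** Equidistribution of [root_coord] turns the product into q times the sum of [f] over the field.
    The value at 0 gives q [T 1]; each x = yz contributes [T (s h)] with [h] in [X_s] depending on z
    only, and y takes a values. *)
Lemma hecke_T_simple_sq i :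
  T (s i) *m T (s i)
    = #|F|%:R *: T 1%g + #|Fa|%:R *: \sum_(d in Xset Fb i) T (s i * d)%g.
Proof.
pose h (u : {unit F}) := diag_GL (refl_torus i u (unitN1 F * u^-1)%g).
(* The value of [e s b s e] in terms of the root coordinate of [b]; at 0, where [insub] fails,
   [s b s] lies in [B] and the value is [e]. *)
pose f (y : F) := if insub y is Some u then e *m gelt (s i * h u)%g *m e else e.
have fE u : f (val u) = e *m gelt (s i * h u)%g *m e by rewrite /f valK.
have f0 : f 0 = e by rewrite /f insubF ?unitr0.
rewrite hecke_T1 [in LHS]hecke_T_simple -scalemxAl -scalemxAr scalerA -!mulmxA.
rewrite (mulmxA e e) ee !mulmxA (idem_mul_idem K (borel_group n Fa)).
rewrite (eq_bigr (fun b => f (root_coord i b))) => [|b Bb]; last first.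
  have [b0|nz_b] := eqVneq (root_coord i b) 0.
    by rewrite b0 f0 (@mul_idem_gelt _ _ (borel_group n Fa)) ?ee ?refl_conj_borel.
  have ub : root_coord i b \is a GRing.unit by rewrite unitfE.
  have [c [d [Bc Bd ->]]] := refl_step (x := FinRing.unit F ub) Bb (erefl _).
  rewrite -[root_coord i b]/(val (FinRing.unit F ub)) fE.
  exact: (@idem_mul_dcoset _ _ (borel_group n Fa)).
have rootD (z : F) : {in B, forall b : gT, root_GL i z * b \in B}%g.
  by move=> b Bb; apply: borelM Bb; apply/unitriangular_borel/root_unitriangular.
have := sum_root_coord f (fun b => id) rootD.
rewrite -(scaler_nat #|F|) -(scaler_nat #|B|) scalerA -mulrA [X in _ * X]mulrC mulrA.
rewrite -scalerA => ->; rewrite scalerA mulfVK //.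
rewrite (bigD1 0) //= f0 scalerDr; congr (_ + _).
rewrite (reindex_omap (val : {unit F} -> F) insub) => [|z nz_z]; last first.
  by case: insubP => [u _ /= ->|] //; rewrite unitfE nz_z.
rewrite (eq_bigl (mem [set: {unit F}])) => [|u]; last first.
  by rewrite valK eqxx andbT -unitfE inE in_setT; apply: (valP u).
rewrite (reindex_dprod dprodF) scaler_sumr (scaler_nat #|Fa|) -[RHS]sumr_const.
apply: eq_bigr => y Fay; rewrite big_imset => [|z z' _ _]; last first.
  rewrite !h2E => /(congr1 (fun g : gT => g (lo i) (lo i))).
  by rewrite !diag_GLE !ffunE !eqxx => /val_inj.
rewrite scaler_sumr; apply: eq_bigr => z Fbz; rewrite fE -hecke_T_simple_diag /h.
(* The part with entries in [F_a] crosses [s] and is absorbed by [B_a] on the left. *)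
rewrite refl_torus_dprod mulgA perm_diag_GL -(mulgA (diag_GL _)) -[X in T X]mulg1.
apply: (@dcoset_sum_dcoset K _ (borel_group n Fa)) => //.
apply: diag_borel => j; rewrite !ffunE; case: (_ == _) => //.
by case: (_ == _) => //; rewrite groupM ?groupV ?expg_card_mem.
Qed.

Let Hb1 : 1%g \in Hb.
Proof. by rewrite -diag_GL1 mem_diagonals // => j; rewrite ffunE group1. Qed.

Let HbM d d' : d \in Hb -> d' \in Hb -> (d * d')%g \in Hb.
Proof.
case/diagonalsP=> u Hu -> /diagonalsP[v Hv ->].
by rewrite -diag_GLM mem_diagonals // => j; rewrite ffunE groupM.
Qed.

(** The sign (-1)^(b-1) lies in [Fb]: the b-th power of its component in [Fa] is (-1)^(b(b-1)) = 1,
    while the order of that component divides a, which is prime to b. *)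
Lemma Xset_diagonals i d : d \in Xset Fb i -> d \in Hb.
Proof.
case/imsetP=> z Fbz ->; rewrite h2E mem_diagonals // => j; rewrite ffunE.
case: (j == lo i) => //; case: (j == hi i); rewrite ?group1 // groupM ?groupV //.
have [y [t [Fay Fbt def_N1 _]]] := mem_dprod dprodF (in_setT (unitN1 F ^+ (#|Fb| - 1))%g).
suffices y1 : y = 1%g by rewrite def_N1 y1 mul1g.
apply/eqP; rewrite -order_eq1 -dvdn1 -(eqP coFab) dvdn_gcd order_dvdG //= order_dvdn.
have /eqP := congr1 (fun v : {unit F} => v ^+ #|Fb|)%g def_N1.
rewrite expgMn; last exact: unit_mulgC.
rewrite (expg_cardG Fbt) mulg1 => /eqP <-; rewrite -expgM.
have : ~~ odd ((#|Fb| - 1) * #|Fb|).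
  by case: #|Fb| => // k; rewrite subn1 oddM /= andbN.
rewrite -dvdn2 => /dvdnP[k ->]; rewrite mulnC expgM expgS expg1 unitN1K.
by rewrite expg1n.
Qed.

(** Write [T w] as [T w'] times [T s], with an ascent from [w'] to [w], and expand the square of
    [T s]. *)
Lemma hecke_T_descent w i : ascent (w * tperm (lo i) (hi i))%g i ->
  T (P w) *m T (s i) = #|F|%:R *: T (P w * s i)%g
                      + #|Fa|%:R *: \sum_(d in Xset Fb i) T (P w * d)%g.
Proof.
move=> asc; set w' := (w * _)%g in asc.
have def_w' : (P w * s i)%g = P w' by rewrite perm_GLM.
have def_w : P w = (P w' * s i)%g by rewrite -def_w' -mulgA refl_GLK mulg1.
rewrite def_w' {1}def_w -hecke_T_ascent // -mulmxA hecke_T_simple_sq.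
rewrite hecke_T1 mulmxDr -!(scalemxAr _%:R) Te mulmx_sumr; congr (_ + _ *: _).
apply: eq_bigr => d /Xset_diagonals Hd.
by rewrite -hecke_T_diagR // mulmxA hecke_T_ascent // hecke_T_diagR // -def_w.
Qed.

Lemma hecke_relations_mulmx : hecke_relations K n Fa Fb mulmx.
Proof.
split=> [d' d Hd' _|w d _ Hd|_ /weylP[w ->] i /=].
- exact: hecke_T_diagL.
- by split; [apply: hecke_T_diagR | apply: hecke_T_diagL].
set ws := (P w * s i)%g.
have -> : weyl_length ws = #|inversions (w * tperm (lo i) (hi i))^-1%g|.
  by rewrite /ws -perm_GLM weyl_lengthE.
rewrite weyl_lengthE {}/ws; have [asc|asc] := weyl_ascent w i.
  rewrite card_inversions_ascent //; split=> [_|]; first exact: hecke_T_ascent.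
  by rewrite ltnNge leqnSn.
rewrite (@card_inversions_descent n w i); last first.
  by move: asc; rewrite invMg tpermV !permM tpermL tpermR.
split=> [|_]; first by rewrite ltnNge leqnSn.
exact: hecke_T_descent.
Qed.

(** * The basis and the torus subalgebra *)

Notation WH := (weyl F n * diagonals n Fb)%g.

Let dcoset_refl x : x \in (B :* x * B)%g.
Proof.
by rewrite -[X in X \in _]mulg1 mem_mulg ?rcoset_refl.
Qed.

Lemma hecke_T_free (D : {set gT}) : D \subset WH -> free [seq T x | x in D].
Proof.
move/subsetP=> sDWH; apply: (@free_gsum K gT) => [|x _|x y Dx Dy].
- by rewrite invr_neq0.
- exact: dcoset_refl.
by case/dprodP: dprodF => _ _ _ /bruhat_inj; apply; apply: sDWH.
Qed.

Let galgM X Y : X \in galg K [set: gT] -> Y \in galg K [set: gT] ->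
  X *m Y \in galg K [set: gT].
Proof. by rewrite !galgT; apply: envelop_mxM. Qed.

Lemma gelt_galg (A : {set gT}) g : g \in A -> gelt g \in galg K A.
Proof. by move=> Ag; apply/memv_span/imageP; exists g. Qed.

Let e_galg : e \in galg K [set: gT].
Proof.
by rewrite memvZ // gsumE memv_suml // => g _; rewrite gelt_galg ?inE.
Qed.

Lemma heckeP X :
  reflect (X \in galg K [set: gT] /\ e *m X *m e = X) (X \in H).
Proof.
have eXe Y : linfun (fun X : 'M_#|[set: gT]| => e *m X *m e) Y = e *m Y *m e.
  exact: (lfunE (mulmxr e \o mulmx e)).
apply: (iffP memv_imgP) => [[Y GY ->]|[GX eX]].
  by rewrite eXe !galgM // -!mulmxA ee !mulmxA ee.
by exists X; rewrite ?eXe.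
Qed.

Lemma hecke_T_mem x : T x \in H.
Proof.
apply/heckeP; split; last by rewrite eT Te.
by rewrite memvZ // gsumE memv_suml // => g _; rewrite gelt_galg ?inE.
Qed.

(** The elements [e g e] span, and the Bruhat decomposition makes each of them a multiple of some
    [T x], characteristic 0 allowing division by the size of the double coset. *)
Lemma hecke_T_basis : basis_of H [seq T x | x in WH].
Proof.
rewrite /basis_of hecke_T_free // andbT eqEsubv; apply/andP; split.
  by apply/span_subvP=> _ /imageP[x _ ->]; apply: hecke_T_mem.
apply/subvP=> X /heckeP[GX <-].
rewrite -[_ *m e](lfunE (mulmxr e \o mulmx e)).
have := memv_img (linfun (mulmxr e \o mulmx e)) GX; rewrite limg_span.
apply: subvP; apply/span_subvP=> _ /mapP[_ /imageP[g _ ->] ->].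
have [x [b [c [WHx Bb Bc ->]]]] := bruhat_cover g (dprodW dprodF).
rewrite lfunE /= (@idem_mul_dcoset _ _ (borel_group n Fa)) //.
have nz_c : #|(B :* x * B)%g|%:R != 0 :> K by rewrite (natr_card_neq0 (x := x) charK).
have -> : e *m gelt x *m e = (#|B|%:R / #|(B :* x * B)%g|%:R) *: T x.
  by rewrite hecke_TE scalerA mulrA mulfVK // mulfV // scale1r.
by apply/memvZ/memv_span/imageP; exists x.
Qed.

Lemma hecke_law_mulmx : algebra_law H mulmx.
Proof.
split=> [X Y|c X Y Z _ _ _|c X Y Z _ _ _|X Y Z _ _ _].
- move=> /heckeP[GX eX] /heckeP[GY eY]; apply/heckeP; split; first exact: galgM.
  by rewrite -eX -eY !mulmxA ee -!mulmxA ee.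
- by rewrite mulmxDl scalemxAl.
- by rewrite mulmxDr scalemxAr.
exact: mulmxA.
Qed.

Lemma galg_idem_comm X : X \in galg K Hb -> X *m e = e *m X.
Proof.
move=> HbX; apply/eqP; rewrite -subr_eq0.
pose c := linfun (mulmxr e) - linfun (mulmx e) : 'End('M[K]_#|[set: gT]|).
have cE Y : c Y = Y *m e - e *m Y by rewrite add_lfunE opp_lfunE !lfunE.
rewrite -cE -memv_ker; apply: subvP HbX; apply/span_subvP=> _ /imageP[d Hd ->].
by rewrite memv_ker cE (norm_idem K (nB Hd)) subrr.
Qed.

(** The map is right multiplication by [e], multiplicative because [e] is idempotent and commutes
    with the group algebra of [Hb]. *)
Lemma hecke_torus_iso : exists f : 'End('M[K]_#|[set: gT]|),
  [/\ {in Hb, forall d, f (gelt d) = T d},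
      {in galg K Hb &, forall X Y, f (X *m Y) = f X *m f Y},
      {in galg K Hb &, injective f}
    & (f @: galg K Hb)%VS = <<[seq T d | d in Hb]>>%VS].
Proof.
pose f : 'End('M[K]_#|[set: gT]|) := linfun (mulmxr e).
have fE X : f X = X *m e by rewrite lfunE.
have fT : {in Hb, forall d, f (gelt d) = T d}.
  by move=> d Hd; rewrite fE -(dcoset_sum_norm K (nB Hd)).
have imf : (f @: galg K Hb)%VS = <<[seq T d | d in Hb]>>%VS.
  rewrite limg_span -map_comp; congr span; apply/eq_in_map=> d.
  by rewrite mem_enum => /fT.
have free_T : free [seq T d | d in Hb].
  apply: hecke_T_free; apply/subsetP=> d Hd; rewrite -[d]mul1g mem_mulg //.
  by rewrite -(perm_GL1 F n) mem_weyl.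
(* The domain is spanned by as many elements as there are independent [T d] in the image, so no
   dimension is left for the kernel. *)
have kerf : (galg K Hb :&: lker f)%VS = 0%VS.
  apply/eqP; rewrite -dimv_eq0 -leqn0 -(leq_add2r (\dim (f @: galg K Hb))).
  rewrite limg_ker_dim add0n imf (eqnP free_T).
  by rewrite (leq_trans (dim_span _)) // !size_map.
exists f; split=> // [X Y HX HY|X Y HX HY eqf].
  by rewrite !fE mulmxA -(mulmxA X e) -galg_idem_comm // -!mulmxA ee.
apply/eqP; rewrite -subr_eq0 -memv0 -kerf memv_cap rpredB //=.
by rewrite memv_ker linearB /= eqf subrr.
Qed.

(** * The relations determine the multiplication *)

Section Uniqueness.
Variable mul : 'M[K]_#|[set: gT]| -> 'M[K]_#|[set: gT]| -> 'M[K]_#|[set: gT]|.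
Hypotheses (mul_law : algebra_law H mul) (mul_rel : hecke_relations K n Fa Fb mul).

Let mul_linl c : {in H & &, forall X Y Z,
  mul (c *: X + Y) Z = c *: mul X Z + mul Y Z}.
Proof. by case: mul_law => _ + _ _; apply. Qed.
Let mul_linr c : {in H & &, forall X Y Z,
  mul X (c *: Y + Z) = c *: mul X Y + mul X Z}.
Proof. by case: mul_law => _ _ + _; apply. Qed.
Let mul_assoc X Y Z : X \in H -> Y \in H -> Z \in H ->
  mul X (mul Y Z) = mul (mul X Y) Z.
Proof. by case: mul_law => _ _ _; apply. Qed.

(** An abstract law is controlled on [H] only, so linearity is asked there alone and the comparison
    runs through coordinates in the basis. *)
Let hecke_span (g1 g2 : 'M[K]_#|[set: gT]| -> 'M[K]_#|[set: gT]|) :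
    (forall c, {in H &, forall X Y, g1 (c *: X + Y) = c *: g1 X + g1 Y}) ->
    (forall c, {in H &, forall X Y, g2 (c *: X + Y) = c *: g2 X + g2 Y}) ->
    (forall w d, d \in Hb -> g1 (T (P w * d)%g) = g2 (T (P w * d)%g)) ->
  {in H, g1 =1 g2}.
Proof.
move=> lin1 lin2 eqT X; rewrite -(span_basis hecke_T_basis) => spX.
have g0 (g : 'M[K]_#|[set: gT]| -> 'M[K]_#|[set: gT]|) :
    (forall c, {in H &, forall X Y, g (c *: X + Y) = c *: g X + g Y}) -> g 0 = 0.
  move=> /(_ 1 0 0 (mem0v _) (mem0v _)); rewrite scale1r addr0 scale1r.
  by move/(canLR (addrK _)); rewrite subrr.
rewrite -[image _ _]in_tupleE in spX; rewrite (coord_span spX).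
set Y := \sum_(i < _) _; suffices [] : Y \in H /\ g1 Y = g2 Y by [].
apply: (big_ind (fun Y => Y \in H /\ g1 Y = g2 Y)) => [|Y1 Y2 [HY1 eq1] [HY2 eq2]|i _].
- by rewrite mem0v !g0.
- by rewrite memvD // -[Y1]scale1r lin1 // lin2 // eq1 eq2.
set Z := _`_i; have : Z \in [seq T x | x in WH] by rewrite mem_nth.
case/imageP=> _ /mulsgP[_ d /weylP[w ->] Hd ->] ->; have HT := hecke_T_mem.
split; first exact/memvZ/HT.
rewrite -[_ *: _]addr0 (lin1 _ _ _ (HT _) (mem0v _)) (lin2 _ _ _ (HT _) (mem0v _)).
by rewrite eqT // (g0 g1) // (g0 g2).
Qed.

Let WdE w d : d \in Hb -> exists2 d', d' \in Hb & (P w * d = d' * P w)%g.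
Proof.
case/diagonalsP=> u Hu ->; exists (diag_GL [ffun j => u (w j)]).
  by rewrite mem_diagonals // => j; rewrite ffunE.
by rewrite perm_diag_GL.
Qed.

Let mul_dd d d' : d \in Hb -> d' \in Hb -> mul (T d) (T d') = T (d * d')%g.
Proof. by case: mul_rel => + _ _; apply. Qed.
Let mul_wd w d : d \in Hb -> mul (T (P w)) (T d) = T (P w * d)%g.
Proof. by case: mul_rel => _ + _ => /(_ _ _ (mem_weyl F w)) h /h[]. Qed.
Let mul_dw w d : d \in Hb -> mul (T d) (T (P w)) = T (d * P w)%g.
Proof. by case: mul_rel => _ + _ => /(_ _ _ (mem_weyl F w)) h /h[]. Qed.
Let mul_ws w i : mul (T (P w)) (T (s i)) = T (P w) *m T (s i).
Proof.
have [_ _ /(_ _ (mem_weyl F w) i)[up dn]] := mul_rel.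
have [_ _ /(_ _ (mem_weyl F w) i)[up' dn']] := hecke_relations_mulmx.
have [lt_ws|lt_ws|] := ltngtP (weyl_length (P w)) (weyl_length (P w * s i)%g).
- by rewrite up // up'.
- by rewrite dn // dn'.
(* Equal lengths cannot occur: the numbers of inversions differ by one. *)
rewrite -perm_GLM !weyl_lengthE; have [asc|asc] := weyl_ascent w i.
  by rewrite card_inversions_ascent // => /n_Sn.
rewrite (@card_inversions_descent n w i) => [/esym/n_Sn //|].
by move: asc; rewrite invMg tpermV !permM tpermL tpermR.
Qed.

Let diag_mul d X : d \in Hb -> X \in H -> mul (T d) X = T d *m X.
Proof.
move=> Hd; have HT := hecke_T_mem.
apply: (@hecke_span (mul (T d)) (mulmx (T d))) =>
  [c Y Z|c Y Z _ _|w d' /(WdE w)[d2 Hd2 ->]].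
- by move=> HY HZ; apply: mul_linr => //; apply: hecke_T_mem.
- by rewrite mulmxDr scalemxAr.
have Hdd : (d * d2)%g \in Hb by apply: HbM.
rewrite hecke_T_diagL // -mul_dw // mul_assoc ?HT // mul_dd // mul_dw //.
by rewrite mulgA.
Qed.

(** Right factors on which the two products agree. Associativity makes them stable under products,
    so generators suffice. *)
Let good Y := Y \in H /\ {in H, forall X, mul X Y = X *m Y}.

Let goodM Y Z : good Y -> good Z -> good (Y *m Z).
Proof.
move=> [HY gY] [HZ gZ]; have [HM _ _ _] := hecke_law_mulmx; split; first exact: HM.
by move=> X HX; rewrite mulmxA -(gZ Y) // mul_assoc // gY // gZ ?HM.
Qed.

Let good_d d : d \in Hb -> good (T d).
Proof.
move=> Hd; have HT := hecke_T_mem; split=> [|X]; first exact: HT.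
apply: (@hecke_span (mul^~ (T d)) (mulmx^~ (T d))) => [c Y Z HY HZ|c Y Z _ _|w d' Hd'] /=.
- by apply: mul_linl => //; apply: hecke_T_mem.
- by rewrite mulmxDl scalemxAl.
have Hdd : (d' * d)%g \in Hb by apply: HbM.
rewrite hecke_T_diagR // -mul_wd // -mul_assoc ?HT // mul_dd // mul_wd //.
by rewrite mulgA.
Qed.

Let good_s i : good (T (s i)).
Proof.
have HT := hecke_T_mem; split=> [|X]; first exact: HT.
apply: (@hecke_span (mul^~ (T (s i))) (mulmx^~ (T (s i)))) =>
  [c Y Z HY HZ|c Y Z _ _|w d /(WdE w)[d' Hd' ->]] /=.
- by apply: mul_linl => //; apply: hecke_T_mem.
- by rewrite mulmxDl scalemxAl.
have [HM _ _ _] := hecke_law_mulmx.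
(* With the diagonal factor moved to the left, associativity isolates the product of [T w] and
   [T s], known from the relations; [diag_mul] handles the outer factor. *)
rewrite -mul_dw // -mul_assoc ?HT // mul_ws diag_mul ?HM ?HT // mulmxA.
by rewrite hecke_T_diagL // mul_dw.
Qed.

Lemma hecke_mul_unique : {in H &, forall X Y, mul X Y = X *m Y}.
Proof.
move=> X Y HX; apply: (@hecke_span (mul X) (mulmx X)) Y => [c Y Z|c Y Z _ _|w d Hd].
- by move=> HY HZ; apply: mul_linr => //; apply: hecke_T_mem.
- by rewrite mulmxDr scalemxAr.
(* The basis element is [T w] times [T d], and [T w] is a product of simple [T s] along a chain of
   ascents. *)
suffices gw : good (T (P w)).
  by rewrite -hecke_T_diagR //; have [_ ->] := goodM gw (good_d Hd).
elim/perm_ascent_ind: w {Hd} => [|w i asc gw].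
  by rewrite perm_GL1; apply: good_d.
by rewrite perm_GLM -hecke_T_ascent //; apply: goodM.
Qed.

End Uniqueness.
End HeckeAlgebra.

Local Open Scope complex_scope.
Unset Implicit Arguments.

Theorem theorem2p4 (R : realType) (F : finFieldType) (q n a b : nat)
    (Fa Fb : {group {unit F}})
    (hq : #|F| = q) (hn : (1 <= n)%N) (ha : (0 < a)%N) (hb : (0 < b)%N)
    (hcop : coprime a b) (hab : (a * b)%N = (q - 1)%N)
    (hFa : #|Fa| = a) (hFb : #|Fb| = b) :
  let W := weyl F n in
  let Hb := diagonals n Fb in
  let H := hecke R[i] n Fa in
  let T := @hecke_T R[i] F n Fa in
  [/\ basis_of H [seq T x | x in (W * Hb)%g],
      algebra_law H mulmx /\ hecke_relations R[i] n Fa Fb mulmx,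
      exists f : 'End('M[R[i]]_#|[set: {'GL_n[F]}]|),
        [/\ {in Hb, forall d, f (gelt R[i] d) = T d},
            {in galg R[i] Hb &, forall X Y, f (X *m Y) = f X *m f Y},
            {in galg R[i] Hb &, injective f}
          & (f @: galg R[i] Hb)%VS = <<[seq T d | d in Hb]>>%VS]
    & forall mul, algebra_law H mul ->
          hecke_relations R[i] n Fa Fb mul ->
        {in H &, forall X Y, mul X Y = X *m Y}].
Proof.
have tiF : Fa :&: Fb = 1%g by apply: coprime_TIg; rewrite hFa hFb.
have dprodF : (Fa \x Fb)%g = [set: {unit F}].
  rewrite dprodE //; last first.
    by apply/centsP=> x _ y _; apply: unit_mulgC.
  (* The product has ab = q - 1 elements, as many as the unit group. *)
  apply/eqP; rewrite eqEcard subsetT /= (TI_cardMg tiF) hFa hFb hab -hq.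
  by rewrite card_finField_unit subn1.
have charK := Num.Theory.pchar_num R[i].
have coF : coprime #|Fa| #|Fb| by rewrite hFa hFb.
split.
- exact: hecke_T_basis.
- by split; [apply: hecke_law_mulmx | apply: hecke_relations_mulmx].
- exact: hecke_torus_iso.
by move=> mul; apply: hecke_mul_unique.
Qed.
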